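(* Let $d,n\in\mathbb{N}$, $r,T>0$, $\hat\alpha=(\alpha_1,\dots,\alpha_d)\in(0,1]^d$, $A,B\in\mathbb{R}^{d\times d}$, $E\in\mathbb{R}^{d\times n}$, $C=(c_{ij})\in\mathbb{R}^{n\times d}$, $D=(d_{ij})\in\mathbb{R}^{n\times n}$, with $$\sum_{k=1}^d|c_{ik}|<1\quad\text{and}\quad \sum_{j=1}^n|d_{ij}|<1\qquad\text{for all } i=1,\dots,n.$$ Consider the system $$(\ast)\qquad\begin{cases}{}^{C}D^{\hat\alpha}_{0^+}x(t)=Ax(t)+Bx(t-\tau_1(t))+Ey(t-\tau_2(t))+f(t), & t\in(0,T],\\ y(t)=Cx(t)+Dy(t-\tau_3(t))+g(t), & t\in[0,T].\end{cases}$$ Suppose that $(\ast)$ is positive for some continuous delays $\tau_k:[0,T]\to\mathbb{R}_{\ge0}$ ($k=1,2,3$) satisfying $t-\tau_k(t)\ge -r$ for all $t\in[0,T]$ and $\tau_k(0)>0$ for $k=1,2,3$. Then $A$ is Metzler and $B,C,D,E$ are nonnegative. As a consequence, $(\ast)$ is also positive for arbitrary continuous delays $\tau_k:[0,T]\to\mathbb{R}_{\ge0}$ ($k=1,2,3$) satisfying $t-\tau_k(t)\ge -r$ for all $t\in[0,T]$.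
   Context: For $\alpha\in(0,1]$, $I^\alpha_{0^+}u(t)=\frac{1}{\Gamma(\alpha)}\int_0^t(t-s)^{\alpha-1}u(s)\,ds$ (with $I^0_{0^+}u=u$), and the Caputo fractional derivative is ${}^{C}D^{\alpha}_{0^+}u(t)=\frac{d}{dt}I^{1-\alpha}_{0^+}(u(t)-u(0))$ for $t>0$; ${}^{C}D^{\hat\alpha}_{0^+}x(t)=({}^{C}D^{\alpha_1}_{0^+}x_1(t),\dots,{}^{C}D^{\alpha_d}_{0^+}x_d(t))^{\rm T}$. A square matrix is Metzler if its off-diagonal entries are nonnegative; a matrix is nonnegative if all its entries are; $\succeq$ is the entrywise order. For continuous $f:[0,T]\to\mathbb{R}^d$, $g:[0,T]\to\mathbb{R}^n$, $\psi:[-r,0]\to\mathbb{R}^d$, $\varphi:[-r,0]\to\mathbb{R}^n$ satisfying the compatibility condition $C\psi(0)+D\varphi(-\tau_3(0))+g(0)=\varphi(0)$, $\Phi(\cdot;\psi,\varphi)=(x,y)^{\rm T}$ denotes the solution of the system with $x=\psi$, $y=\varphi$ on $[-r,0]$, i.e. the (under the stated row-sum conditions, unique) continuous function $[-r,T]\to\mathbb{R}^{d+n}$ satisfying the equations and the initial condition. For given delays, the system is called positive if for all continuous $f,g\succeq 0$ on $[0,T]$ and all continuous $\psi,\varphi\succeq0$ on $[-r,0]$ satisfying the compatibility condition, $\Phi(t;\psi,\varphi)\succeq 0$ for all $t\in[0,T]$. *)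

(* Defs.v *)
From HB Require Import structures.
From mathcomp Require Import all_boot all_order all_algebra.
From mathcomp Require Import all_classical all_reals all_analysis.

Set Implicit Arguments.
Unset Strict Implicit.
Unset Printing Implicit Defensive.

Import Order.TTheory GRing.Theory Num.Theory.
Import numFieldNormedType.Exports.

Local Open Scope classical_set_scope.
Local Open Scope ring_scope.

Definition nonneg_mx (R : realType) (m n : nat) (M : 'M[R]_(m, n)) : Prop :=
  forall i j, 0 <= M i j.

Definition metzler (R : realType) (d : nat) (A : 'M[R]_d) : Prop :=
  forall i j, i != j -> 0 <= A i j.

Definition euler_Gamma (R : realType) (a : R) : R :=
  \int[@lebesgue_measure R]_(s in `]0, +oo[) (s `^ (a - 1) * expR (- s)).

Definition frac_int (R : realType) (a : R) (u : R -> R) (t : R) : R :=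
  if a == 0 then u t
  else (euler_Gamma a)^-1 *
    \int[@lebesgue_measure R]_(s in `[0, t]) ((t - s) `^ (a - 1) * u s).

(* The derivative is taken relative to [0, T]: two-sided at t in ]0, T[ and
   one-sided at t = T.  Functions are total on R, and only their values on the
   interval of interest may matter. *)
Definition is_derive_on (R : realType) (T : R) (F : R -> R) (t l : R) : Prop :=
  (F s - F t) / (s - t) @[s --> within `[0, T] t^'] --> l.

Definition is_caputo (R : realType) (T a : R) (u : R -> R) (t l : R) : Prop :=
  is_derive_on T (frac_int (1 - a) (fun s => u s - u 0)) t l.

Definition admissible_delay (R : realType) (r T : R) (tau : R -> R) : Prop :=
  {within `[0, T], continuous tau} /\
  forall t, t \in `[0, T] -> 0 <= tau t /\ - r <= t - tau t.

Section System.
Variables (R : realType) (d n : nat) (r T : R) (alpha : 'I_d -> R).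
Variables (A B : 'M[R]_d) (E : 'M[R]_(d, n)) (C : 'M[R]_(n, d)) (D : 'M[R]_n).
Variables (tau1 tau2 tau3 : R -> R).
Implicit Types (f psi x : R -> 'cV[R]_d) (g phi y : R -> 'cV[R]_n).

Definition compatible g psi phi : Prop :=
  C *m psi 0 + D *m phi (- tau3 0) + g 0 = phi 0.

Definition is_solution f g psi phi x y : Prop :=
  [/\ {within `[- r, T], continuous x} /\ {within `[- r, T], continuous y},
      forall t, t \in `[- r, 0] -> x t = psi t /\ y t = phi t,
      forall t, t \in `]0, T] -> forall i : 'I_d,
        is_caputo T (alpha i) (fun s => x s i 0) t
          ((A *m x t + B *m x (t - tau1 t) + E *m y (t - tau2 t) + f t) i 0)
    & forall t, t \in `[0, T] ->
        y t = C *m x t + D *m y (t - tau3 t) + g t].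

(* Quantifying over every solution (x, y) stands for the solution Phi(.; psi, phi),
   which exists and is unique when the rows of C and D have l1-norm below 1. *)
Definition positive_system : Prop :=
  forall f g psi phi,
    {within `[0, T], continuous f} -> {within `[0, T], continuous g} ->
    {within `[- r, 0], continuous psi} -> {within `[- r, 0], continuous phi} ->
    (forall t, t \in `[0, T] -> nonneg_mx (f t) /\ nonneg_mx (g t)) ->
    (forall t, t \in `[- r, 0] -> nonneg_mx (psi t) /\ nonneg_mx (phi t)) ->
    compatible g psi phi ->
    forall x y, is_solution f g psi phi x y ->
    forall t, t \in `[0, T] -> nonneg_mx (x t) /\ nonneg_mx (y t).

End System.

(* Main.v *)
Require Import Defs.
From HB Require Import structures.
From mathcomp Require Import all_boot all_order all_algebra.
From mathcomp Require Import all_classical all_reals all_analysis.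
From mathcomp Require Import measurable_realfun.
From mathcomp Require Import ring lra.

Set Implicit Arguments.
Unset Strict Implicit.
Unset Printing Implicit Defensive.

Import Order.TTheory GRing.Theory Num.Theory.
Import numFieldNormedType.Exports.

Local Open Scope classical_set_scope.
Local Open Scope ring_scope.

(** The two halves of the theorem meet in the sign conditions on the matrices.

    From signs to positivity.  Let (x, y) be a solution with nonnegative data.
    Perturb it by a small multiple of a strict supersolution: state components
    1 + N V_i, where V_i solves D^(alpha_i) V_i = e with V_i(0) = 0, and output
    components L e, where e is a nondecreasing exponential.  Choosing first L
    (possible because the rows of D have l1-norm below 1), then N, and then the
    rate of e so large that N V_i <= e makes every inequality strict.  Consider
    the first time t0 at which a component of the perturbed solution vanishes.
    An output component cannot vanish, since its equation writes it as a sum of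
    nonnegative terms and a positive one.  A state component cannot either: its
    Caputo derivative at t0 is positive, while [caputo_le0_at_zero_min] says that
    a nonnegative function has a nonpositive Caputo derivative at a zero.  Let the
    perturbation tend to zero.

    The extremum principle [caputo_le0_at_zero_min] is not a computation, because
    the solution is merely continuous and only the derivative of its fractional
    integral I^(1-alpha) exists.  If that derivative were at least c > 0 near t0,
    then the fractional integral G of the part of u living on [t1, t0] would
    increase with slope c, since the earlier part of u contributes a decreasing
    function of t.  Hence so would I^alpha G, up to a constant factor.  But
    I^alpha I^(1-alpha) is the ordinary integral ([rl_kernel_convol], Tonelli and
    the Beta integral), so I^alpha G is a primitive of u, whose slope vanishes at
    t0 with u: this is [rl_conv_increase_pos].  The same identity shows that
    fractional integrals solve D^alpha v = h ([is_caputo_frac_int]).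

    From positivity to signs.  No existence theory is needed: choose (x, y) first
    and read f and g off the equations.  Since the delays are positive at 0, the
    delayed values of the state and of the output are constant vectors p and p'
    on a short initial interval, independent of the values q of the state at 0.
    If (A q + B p + E p')_i < 0 and q_i = 0, then x_i can decrease from 0 with
    f_i nonnegative, and if (C q + D p')_j < 0, then y_j can decrease from 0
    with g_j nonnegative.  After the initial interval both components are
    driven up by an exponential so steep that f and g remain nonnegative on
    [0, T].  This contradicts positivity, so no such i and j exist
    ([no_negative_drive]); taking unit vectors for p, q, p' gives the signs of the
    entries. *)

(** * Affine changes of variables *)

Section ChangeOfVariables.
Context {R : realType}.
Local Notation mu := (@lebesgue_measure R).
Local Open Scope ereal_scope.

Lemma ge0_integral_opp (f : R -> \bar R) :
  measurable_fun setT f -> (forall x, 0 <= f x) ->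
  \int[mu]_x f x = \int[mu]_x f (- x)%R.
Proof.
move=> mf f0.
transitivity (\int[pushforward mu (-%R : _ -> measurableTypeR R)]_x f x).
  by apply: eq_measure_integral => A mA _; exact/esym/lebesgue_measureN.
by rewrite ge0_integral_pushforward.
Qed.

Lemma ge0_integral_affine (c d : R) (f : R -> \bar R) : (0 < c)%R ->
  measurable_fun setT f -> (forall x, 0 <= f x) ->
  \int[mu]_x f x = c%:E * \int[mu]_x f (c * x + d)%R.
Proof.
move=> c0 mf f0.
pose aff := (fun x : R => c * x + d : measurableTypeR R)%R.
have maff : measurable_fun setT aff.
  apply: continuous_measurable_fun => x; apply: cvgD; last exact: cvg_cst.
  by apply: cvgM; [exact: cvg_cst|exact: cvg_id].
pose pm : {measure set (measurableTypeR R) -> \bar R} :=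
    measure_function_pushforward__canonical__measure_function_Measure mu maff.
transitivity (\int[mscale (NngNum (ltW c0)) pm]_x f x).
  apply: eq_measure_integral => A mA _.
  apply: lebesgue_measure_unique => // _ [[a b]] _ <- /=.
  rewrite /mscale/= /pushforward /=.
  have -> : aff @^-1` `]a, b]%classic = `]((a - d) / c)%R, ((b - d) / c)%R]%classic.
    apply/seteqP; split => x /=; rewrite /aff !in_itv/=.
      by rewrite ltr_pdivrMr// ler_pdivlMr// ltrBlDr lerBrDr mulrC.
    by rewrite ltr_pdivrMr// ler_pdivlMr// ltrBlDr lerBrDr mulrC.
  rewrite !lebesgue_measure_itv/= !lte_fin ltr_pM2r ?invr_gt0// ltrD2r.
  case: ifPn => ab; last by rewrite mule0.
  rewrite -!EFinD -EFinM; congr EFin.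
  by field; rewrite gt_eqF.
rewrite ge0_integral_mscale//; congr (_ * _).
by rewrite ge0_integral_pushforward.
Qed.

Lemma ge0_integral_reflect (t : R) (f : R -> \bar R) :
  measurable_fun setT f -> (forall x, 0 <= f x) ->
  \int[mu]_x f x = \int[mu]_x f (t - x)%R.
Proof.
move=> mf f0; rewrite ge0_integral_opp// (@ge0_integral_affine 1 (- t))//.
  by rewrite mul1e; apply: eq_integral => x _; rewrite mul1r opprD opprK addrC.
by apply: measurableT_comp.
Qed.

End ChangeOfVariables.

(** * The Riemann-Liouville kernel *)

Section RLKernel.
Context {R : realType}.
Local Notation mu := (@lebesgue_measure R).

(** The kernel of the fractional integral of order a, without its Gamma factor,
    extended by 0 so that fractional integrals become convolutions on the line.
    The value at 0 is the one that the integrand of [frac_int] takes there. *)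
Definition rl_kernel (a x : R) : R := if 0 <= x then x `^ (a - 1) else 0.

Lemma rl_kernel_ge0 a x : 0 <= rl_kernel a x.
Proof. by rewrite /rl_kernel; case: ifP => // _; exact: powR_ge0. Qed.

Lemma rl_kernel_gt0 a x : 0 < x -> 0 < rl_kernel a x.
Proof. by move=> x0; rewrite /rl_kernel ltW// powR_gt0. Qed.

Lemma rl_kernel_lt0 a x : x < 0 -> rl_kernel a x = 0.
Proof. by move=> x0; rewrite /rl_kernel leNgt x0. Qed.

Lemma measurable_rl_kernel a : measurable_fun setT (rl_kernel a).
Proof.
apply: measurable_fun_ifT; [|exact: measurable_powR|exact: measurable_cst].
exact: (measurable_fun_ler (measurable_cst (0 : R)) (@measurable_id _ R setT)).
Qed.

Lemma rl_kernelM a c x : 0 < c ->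
  rl_kernel a (c * x) = c `^ (a - 1) * rl_kernel a x.
Proof.
move=> c0; rewrite /rl_kernel pmulr_rge0//.
by case: ifPn => x0; rewrite ?mulr0// powRM// ltW.
Qed.

Lemma rl_kernel_nincr a x y : a <= 1 -> 0 < x -> x <= y ->
  rl_kernel a y <= rl_kernel a x.
Proof.
move=> a1 x0 xy; have y0 := lt_le_trans x0 xy.
rewrite /rl_kernel (ltW x0) (ltW y0) -(opprB 1 a) !powRN.
rewrite lef_pV2 ?posrE ?powR_gt0//.
by apply: ge0_ler_powR => //; rewrite ?nnegrE ?subr_ge0// ltW.
Qed.

Lemma continuous_powR (a x : R) : 0 < x -> {for x, continuous (@powR R ^~ a)}.
Proof.
move=> x0; apply: differentiable_continuous; apply/derivable1_diffP.
by apply: derivable_powR; rewrite in_itv/= x0.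
Qed.

Lemma integral_rl_kernel_away0 (a e t : R) : 0 < a -> 0 < e -> e < t ->
  (\int[mu]_(x in `[e, t]) (rl_kernel a x)%:E = ((t `^ a - e `^ a) / a)%:E)%E.
Proof.
move=> a0 e0 et.
have cont x : 0 < x -> {for x, continuous (fun x => x `^ a / a)}.
  by move=> x0; apply: cvgM; [exact: continuous_powR|exact: cvg_cst].
transitivity (\int[mu]_(x in `[e, t]) (x `^ (a - 1))%:E)%E.
  apply: eq_integral => x; rewrite inE/= in_itv/= => /andP[ex _].
  by rewrite /rl_kernel (le_trans (ltW e0)).
rewrite (@continuous_FTC2 _ _ (fun x => x `^ a / a))//.
- by rewrite -EFinB mulrBl.
- apply: continuous_in_subspaceT => x; rewrite inE/= in_itv/= => /andP[ex _].
  by apply: continuous_powR; rewrite (lt_le_trans e0).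
- split.
  + move=> x; rewrite in_itv/= => /andP[ex _].
    by apply: derivableM => //; apply: derivable_powR; rewrite in_itv/= (lt_trans e0).
  + by apply: cvg_at_right_filter; apply: cont.
  + by apply: cvg_at_left_filter; apply: cont; rewrite (lt_trans e0).
- move=> x; rewrite in_itv/= => /andP[ex _].
  have x0 := lt_trans e0 ex.
  have := is_derive1_powR a x0 => d.
  rewrite derive1E deriveM//= derive_cst scaler0 add0r derive_val.
  by rewrite /GRing.scale/= mulrA mulVf ?mul1r// gt_eqF.
Qed.

(** The kernel may be unbounded at 0, so the fundamental theorem of calculus only
    applies on [t / n, t]; the value on [0, t] follows by monotone convergence. *)
Lemma integral_rl_kernel (a t : R) : 0 < a -> 0 <= t ->
  (\int[mu]_(x in `[0%R, t]) (rl_kernel a x)%:E = (t `^ a / a)%:E)%E.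
Proof.
move=> a0; rewrite le_eqVlt => /predU1P[<-|t0].
  by rewrite set_itv1 integral_set1 powR0 ?mul0r// gt_eqF.
rewrite -integral_itv_obnd_cbnd; last first.
  by apply/measurable_EFinP/measurable_funTS; exact: measurable_rl_kernel.
pose F (n : nat) := `[t / n.+2%:R, t]%classic.
have -> : `]0, t]%classic = \bigcup_n F n.
  apply/seteqP; split=> [x/=|x [n _]]; rewrite /F/= !in_itv/=.
    move=> /andP[x0 xt]; exists (Num.truncn (t / x)) => //=.
    rewrite in_itv/= xt andbT ler_pdivrMr// mulrC -ler_pdivrMr// ltW//.
    rewrite (lt_trans (truncnS_gt _))// ltr_nat//.
  by move=> /andP[tx ->]; rewrite (lt_le_trans _ tx)// divr_gt0.
have c1 : (\int[mu]_(x in F n) (rl_kernel a x)%:E @[n --> \oo] -->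
    \int[mu]_(x in \bigcup_n F n) (rl_kernel a x)%:E)%E.
  apply: ge0_nondecreasing_set_cvg_integral.
  - apply/nondecreasing_seqP => n; rewrite subsetEset => x; rewrite /F/= !in_itv/=.
    move=> /andP[+ ->]; rewrite andbT; apply: le_trans.
    by rewrite ler_pM2l// lef_pV2 ?posrE// ler_nat.
  - by move=> n; exact: measurable_itv.
  - by move=> n; apply/measurable_EFinP/measurable_funTS; exact: measurable_rl_kernel.
  - by move=> n x _; rewrite lee_fin rl_kernel_ge0.
have c2 : (\int[mu]_(x in F n) (rl_kernel a x)%:E @[n --> \oo] -->
    (t `^ a / a)%:E)%E.
  have -> : (fun n => \int[mu]_(x in F n) (rl_kernel a x)%:E)%E =
      (fun n => ((t `^ a - (t / n.+2%:R) `^ a) / a)%:E).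
    apply/funext => n; rewrite integral_rl_kernel_away0// ?divr_gt0//.
    by rewrite ltr_pdivrMr// ltr_pMr// ltr1n.
  apply: cvg_EFin; first by near=> n.
  rewrite -[X in _ --> X / a]subr0.
  apply: cvgM; last exact: cvg_cst.
  apply: cvgB; first exact: cvg_cst.
  have /cvg_at_rightP := powR_cvg0 a0; apply; split=> [n|].
    by rewrite divr_gt0.
  rewrite -[X in _ --> X](mulr0 t); apply: cvgM; first exact: cvg_cst.
  have := @cvg_harmonic R; rewrite -(cvg_shiftS (@harmonic R)); exact.
exact: (cvg_unique (@ereal_hausdorff R) c1 c2).
Unshelve. all: end_near. Qed.

End RLKernel.

(** * The Beta integral and the semigroup identity *)

Section BetaKernel.
Context {R : realType}.
Local Notation mu := (@lebesgue_measure R).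

Lemma measurable_rl_kernelB a (t : R) :
  measurable_fun setT (fun s : R => rl_kernel a (t - s)).
Proof.
apply: (measurableT_comp (measurable_rl_kernel a)).
by apply: measurable_funB.
Qed.

Lemma measurable_patchT (D : set R) (f : R -> R) : measurable D ->
  measurable_fun setT f -> measurable_fun setT (f \_ D).
Proof.
move=> mD mf; apply: (iffLR (measurable_restrictT _ mD)).
exact: measurable_funTS.
Qed.

Lemma integral_rl_kernel_patch (a t : R) : 0 < a -> 0 <= t ->
  (\int[mu]_x ((rl_kernel a \_ `[0%R, t]) x)%:E = (t `^ a / a)%:E)%E.
Proof.
move=> a0 t0; rewrite -integral_rl_kernel// [RHS]integral_mkcond.
by apply: eq_integral => x _; rewrite restrict_EFin.
Qed.

(** [euler_Gamma] is a real-valued integral, hence 0 if the integral diverges: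
    both the finiteness and the positivity of the integral are at stake.  The
    integrand is below the kernel on [0, 1] and below exp (- s) beyond. *)
Lemma euler_Gamma_gt0 (b : R) : 0 < b -> b <= 1 -> 0 < euler_Gamma b.
Proof.
move=> b0 b1; rewrite /euler_Gamma /Rintegral.
set f := fun s : R => s `^ (b - 1) * expR (- s).
have f0 s : 0 <= f s by rewrite mulr_ge0// ?powR_ge0 ?expR_ge0.
have mf : measurable_fun setT f.
  apply: measurable_funM; first exact: measurable_powR.
  by apply: measurableT_comp => //; exact: measurableT_comp.
pose g := fun s : R => (rl_kernel b \_ `[0%R, 1%R]) s + exponential_pdf 1 s.
have mrl : measurable_fun setT (rl_kernel b \_ `[0%R, 1%R] : R -> R).
  by apply: measurable_patchT => //; exact: measurable_rl_kernel.
have rl0 s : 0 <= (rl_kernel b \_ `[0%R, 1%R]) s.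
  by rewrite patchE; case: ifP => // _; exact: rl_kernel_ge0.
have fg s : 0 < s -> f s <= g s.
  move=> s0; rewrite /f /g /exponential_pdf !patchE mem_setE in_itv/= (ltW s0)/=.
  rewrite mem_setE in_itv/= (ltW s0)/= mul1r mulN1r.
  case: ifPn => s1.
    rewrite /rl_kernel (ltW s0) -[leLHS]addr0 lerD ?expR_ge0//.
    by rewrite ler_piMr ?powR_ge0// -expR0 ler_expR oppr_le0 ltW.
  rewrite add0r ler_piMl ?expR_ge0//.
  have := @rl_kernel_nincr R b 1 s b1 ltr01.
  rewrite /rl_kernel ler01 (ltW s0) powR1; apply.
  by rewrite -ltNge in s1; exact: ltW.
have fin : (\int[mu]_(s in `]0%R, +oo[) (f s)%:E < +oo)%E.
  apply: (@le_lt_trans _ _ (\int[mu]_s (g s)%:E)%E).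
    apply: (@le_trans _ _ (\int[mu]_(s in `]0%R, +oo[) (g s)%:E)%E).
      apply: ge0_le_integral => //.
      - by move=> s _; rewrite lee_fin f0.
      - by apply/measurable_EFinP/measurable_funTS.
      - apply/measurable_EFinP/measurable_funTS/measurable_funD => //.
        exact: measurable_exponential_pdf.
      - by move=> s /=; rewrite in_itv/= andbT lee_fin; exact: fg.
    apply: ge0_subset_integral => //.
    - apply/measurable_EFinP/measurable_funD => //.
      exact: measurable_exponential_pdf.
    - by move=> s _; rewrite lee_fin addr_ge0// exponential_pdf_ge0.
  rewrite (_ : (fun s => (g s)%:E) = (fun s =>
      ((rl_kernel b \_ `[0%R, 1%R]) s)%:E + (exponential_pdf 1 s)%:E)%E)//.
  rewrite ge0_integralD//.
  - by rewrite integral_rl_kernel_patch// integral_exponential_pdf// -EFinD ltry.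
  - by move=> s _; rewrite lee_fin.
  - exact/measurable_EFinP.
  - by move=> s _; rewrite lee_fin exponential_pdf_ge0.
  - by apply/measurable_EFinP; exact: measurable_exponential_pdf.
have pos : ((expR (-1))%:E <= \int[mu]_(s in `]0%R, +oo[) (f s)%:E)%E.
  apply: (@le_trans _ _ (\int[mu]_(s in `]0%R, 1%R]) (f s)%:E)%E); last first.
    apply: ge0_subset_integral => //.
    - by apply/measurable_EFinP/measurable_funTS.
    - by move=> s _; rewrite lee_fin f0.
    - by move=> s /=; rewrite !in_itv/= => /andP[->].
  have <- : (\int[mu]_(s in `]0%R, 1%R]) (expR (-1))%:E = (expR (-1))%:E)%E.
    by rewrite integral_cst//= lebesgue_measure_itv/= lte_fin ltr01 sube0 mule1.
  apply: ge0_le_integral => //.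
  - by apply/measurable_EFinP/measurable_funTS.
  - move=> s /=; rewrite in_itv/= lee_fin => /andP[s0 s1].
    have := @rl_kernel_nincr R b s 1 b1 s0 s1.
    rewrite /rl_kernel ler01 (ltW s0) powR1 => h.
    rewrite /f -[leLHS]mul1r ler_pM ?expR_ge0// ler_expR.
    by rewrite lerN2.
apply: fine_gt0; rewrite fin andbT.
by apply: lt_le_trans pos; rewrite lte_fin expR_gt0.
Qed.

(** The value B(a, 1 - a) of the Beta function. *)
Definition beta_const (a : R) : R :=
  fine (\int[mu]_s (rl_kernel a (1 - s) * rl_kernel (1 - a) s)%:E)%E.

Let I1 (a : R) := (\int[mu]_s (rl_kernel a (1 - s) * rl_kernel (1 - a) s)%:E)%E.

Let mI1 a t : measurable_fun setT
  (fun s : R => rl_kernel a (t - s) * rl_kernel (1 - a) s).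
Proof.
apply: measurable_funM; first exact: measurable_rl_kernelB.
exact: measurable_rl_kernel.
Qed.

Let I1_lty a : 0 < a < 1 -> (I1 a < +oo)%E.
Proof.
move=> /andP[a0 a1]; set b := 1 - a.
have b0 : 0 < b by rewrite subr_gt0.
have b1 : b <= 1 by rewrite lerBlDr lerDl ltW.
have h0 : 0 < 2^-1 :> R by rewrite invr_gt0.
pose ka := rl_kernel a \_ `[0%R, 1%R].
pose kb := rl_kernel b \_ `[0%R, 1%R].
have k0 c (s : R) : 0 <= (rl_kernel c \_ `[0%R, 1%R]) s.
  by rewrite patchE; case: ifP => // _; exact: rl_kernel_ge0.
have mk c : measurable_fun setT (rl_kernel c \_ `[0%R, 1%R] : R -> R).
  by apply: measurable_patchT => //; exact: measurable_rl_kernel.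
have mka1 : measurable_fun setT (fun s : R => ka (1 - s)).
  by apply: (measurableT_comp (mk a)); apply: measurable_funB.
pose C := rl_kernel a 2^-1; pose D := rl_kernel b 2^-1.
have C0 : 0 <= C := rl_kernel_ge0 _ _.
have D0 : 0 <= D := rl_kernel_ge0 _ _.
have bnd s : rl_kernel a (1 - s) * rl_kernel b s <= C * kb s + D * ka (1 - s).
  have [s0|s0] := ltP s 0.
    rewrite (rl_kernel_lt0 _ s0) mulr0 addr_ge0// mulr_ge0//; exact: k0.
  have [s1|s1] := ltP 1 s.
    rewrite [X in X * _]rl_kernel_lt0 ?subr_lt0// mul0r.
    by rewrite addr_ge0// mulr_ge0//; exact: k0.
  rewrite /kb /ka !patchE !mem_setE !in_itv/= s0 s1/= subr_ge0 s1/=.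
  rewrite lerBlDr lerDl s0.
  have [sh|sh] := leP s 2^-1.
    rewrite ler_wpDr ?mulr_ge0 ?rl_kernel_ge0//.
    rewrite ler_wpM2r ?rl_kernel_ge0// rl_kernel_nincr// ?(ltW a1)//; lra.
  rewrite ler_wpDl ?mulr_ge0 ?rl_kernel_ge0// mulrC.
  by rewrite ler_wpM2r ?rl_kernel_ge0// rl_kernel_nincr// ltW.
apply: (@le_lt_trans _ _ (\int[mu]_s ((C%:E * (kb s)%:E) + (D%:E * (ka (1 - s))%:E)))%E).
  apply: ge0_le_integral => //.
  - by move=> s _; rewrite lee_fin mulr_ge0// rl_kernel_ge0.
  - by apply/measurable_EFinP; exact: mI1.
  - apply/measurable_EFinP; apply: measurable_funD; apply: measurable_funM => //.
    exact: mk.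
  - by move=> s _; rewrite lee_fin; exact: bnd.
rewrite ge0_integralD//; last 4 first.
- by move=> s _; rewrite lee_fin mulr_ge0//; exact: k0.
- by apply/measurable_EFinP; apply: measurable_funM => //; exact: mk.
- by move=> s _; rewrite lee_fin mulr_ge0//; exact: k0.
- by apply/measurable_EFinP; apply: measurable_funM.
rewrite !ge0_integralZl//.
- rewrite (integral_rl_kernel_patch b0 ler01).
  rewrite -(@ge0_integral_reflect _ 1 (fun s => (ka s)%:E))//.
  + by rewrite (integral_rl_kernel_patch a0 ler01) -!EFinM -EFinD ltry.
  + by apply/measurable_EFinP; exact: mk.
  + by move=> s; rewrite lee_fin; exact: k0.
- exact/measurable_EFinP.
- by move=> s _; rewrite lee_fin; exact: k0.
- by apply/measurable_EFinP; exact: mk.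
- by move=> s _; rewrite lee_fin; exact: k0.
Qed.

Let I1_gt0 a : 0 < a < 1 -> (0 < I1 a)%E.
Proof.
move=> /andP[a0 a1]; set b := 1 - a.
have b1 : b <= 1 by rewrite lerBlDr lerDl ltW.
apply: (@lt_le_trans _ _ (\int[mu]_(s in `[4^-1%R, 2^-1%R]) (1 : R)%:E)%E).
  rewrite integral_cst//= mul1e lebesgue_measure_itv/= lte_fin ltf_pV2 ?posrE//.
  by rewrite ltr_nat/= -EFinD lte_fin; lra.
apply: (@le_trans _ _ (\int[mu]_(s in `[4^-1%R, 2^-1%R])
    (rl_kernel a (1 - s) * rl_kernel b s)%:E)%E).
  apply: ge0_le_integral => //.
  - by apply/measurable_EFinP/measurable_funTS; exact: mI1.
  move=> s /=; rewrite in_itv/= lee_fin => /andP[s0 s1].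
  have k1 c x : c <= 1 -> 0 < x -> x <= 1 -> 1 <= rl_kernel c x :> R.
    move=> c1 x0 x1; have := rl_kernel_nincr c1 x0 x1.
    by rewrite {1}/rl_kernel ler01 powR1.
  rewrite -[leLHS]mulr1 ler_pM// k1//; lra.
apply: ge0_subset_integral => //.
- by apply/measurable_EFinP; exact: mI1.
- by move=> s _; rewrite lee_fin mulr_ge0// rl_kernel_ge0.
Qed.

Lemma beta_const_gt0 a : 0 < a < 1 -> 0 < beta_const a.
Proof. by move=> a01; apply: fine_gt0; rewrite I1_gt0//= I1_lty. Qed.

(** The kernels of orders a and 1 - a are homogeneous of total degree -1, so their
    convolution is scale invariant: it is constant on the positive half-line. *)
Lemma rl_kernel_beta a (x : R) : 0 < a < 1 ->
  (\int[mu]_s (rl_kernel a (x - s) * rl_kernel (1 - a) s)%:E)%E =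
  (beta_const a * (0 < x)%R%:R)%:E.
Proof.
move=> a01; have /andP[a0 a1] := a01; set b := 1 - a.
have [x0|x0] := ltP 0 x; last first.
  rewrite mulr0 integral0_eq// => s _.
  have [s0|] := ltP s 0; first by rewrite (rl_kernel_lt0 _ s0) mulr0.
  rewrite le_eqVlt => /predU1P[<-|s0].
    by rewrite {2}/rl_kernel lexx powR0 ?mulr0// /b; lra.
  by rewrite rl_kernel_lt0 ?mul0r//; lra.
rewrite mulr1 /beta_const fineK; last first.
  by rewrite ge0_fin_numE ?I1_lty// ltW// I1_gt0.
rewrite (@ge0_integral_affine _ x 0)//; last 2 first.
- by apply/measurable_EFinP; exact: mI1.
- by move=> s; rewrite lee_fin mulr_ge0// rl_kernel_ge0.
rewrite -ge0_integralZl//; last 3 first.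
- apply/measurable_EFinP; apply: measurable_funM.
    apply: (measurableT_comp (measurable_rl_kernel a)).
    by apply: measurable_funB => //; apply: measurable_funD => //; apply: measurable_funM.
  apply: (measurableT_comp (measurable_rl_kernel b)).
  by apply: measurable_funD => //; apply: measurable_funM.
- by move=> s _; rewrite lee_fin mulr_ge0// rl_kernel_ge0.
- by rewrite lee_fin ltW.
apply: eq_integral => s _; rewrite -EFinM addr0; congr EFin.
rewrite -{2}(mulr1 x) -mulrBr !rl_kernelM//.
rewrite mulrACA mulrA -powRD; last by rewrite (gt_eqF x0) implybT.
have -> : a - 1 + (b - 1) = -1 by rewrite /b; lra.
by rewrite powR_inv1 ?(ltW x0)// !mulrA mulfV ?gt_eqF// mul1r.
Qed.

(** Up to constants, I^a I^(1-a) is the ordinary integral.  Working with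
    nonnegative extended-real integrals, Tonelli applies without any
    integrability condition. *)
Lemma rl_kernel_convol a (w : R -> R) (t : R) : 0 < a < 1 ->
  measurable_fun setT w -> (forall r, 0 <= w r) ->
  (\int[mu]_s ((rl_kernel a (t - s))%:E *
      \int[mu]_r (rl_kernel (1 - a) (s - r) * w r)%:E) =
   (beta_const a)%:E * \int[mu]_(r in `]-oo, t[) (w r)%:E)%E.
Proof.
move=> a01 mw w0; set b := 1 - a.
have mb (u v : measurableTypeR R * measurableTypeR R -> R) c :
  measurable_fun setT u -> measurable_fun setT v ->
  measurable_fun setT (fun p => rl_kernel c (u p - v p)).
  move=> mu_ mv; apply: (measurableT_comp (measurable_rl_kernel c)).
  exact: measurable_funB.
pose F (p : measurableTypeR R * measurableTypeR R) : \bar R :=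
  (rl_kernel a (t - p.1) * (rl_kernel b (p.1 - p.2) * w p.2))%:E.
have mF : measurable_fun setT F.
  apply/measurable_EFinP; apply: measurable_funM; first exact: mb.
  apply: measurable_funM; first exact: mb.
  exact: measurableT_comp.
have F0 p : (0 <= F p)%E by rewrite lee_fin !mulr_ge0 ?rl_kernel_ge0.
transitivity (\int[mu]_s \int[mu]_r F (s, r))%E.
  apply: eq_integral => s _; rewrite -ge0_integralZl//.
  - by apply/measurable_EFinP; apply: measurable_funM => //; exact: measurable_rl_kernelB.
  - by move=> r _; rewrite lee_fin mulr_ge0 ?rl_kernel_ge0.
  - by rewrite lee_fin rl_kernel_ge0.
rewrite fubini_tonelli//.
rewrite -ge0_integralZl//; last 3 first.
- by apply/measurable_EFinP/measurable_funTS.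
- by move=> r _; rewrite lee_fin.
- by rewrite lee_fin ltW// beta_const_gt0.
rewrite [RHS]integral_mkcond; apply: eq_integral => r _; rewrite /F/=.
rewrite patchE mem_setE in_itv/=.
transitivity ((w r)%:E * (beta_const a * (0 < t - r)%R%:R)%:E)%E; last first.
  rewrite subr_gt0; case: ifP => _; first by rewrite mulr1 muleC.
  by rewrite mulr0 mule0.
rewrite -rl_kernel_beta// -ge0_integralZl//; last 3 first.
- by apply/measurable_EFinP; exact: mI1.
- by move=> s _; rewrite lee_fin mulr_ge0// rl_kernel_ge0.
- by rewrite lee_fin.
rewrite (@ge0_integral_affine _ 1 r)//; last 2 first.
- apply/measurable_EFinP; apply: measurable_funM; first exact: measurable_rl_kernelB.
  apply: measurable_funM => //; apply: (measurableT_comp (measurable_rl_kernel b)).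
  exact: measurable_funB.
- by move=> s; rewrite lee_fin !mulr_ge0 ?rl_kernel_ge0.
rewrite mul1e; apply: eq_integral => s _; rewrite -EFinM mul1r addrK.
by congr EFin; rewrite (addrC s) opprD addrA; ring.
Qed.

End BetaKernel.

(** * Convolution with the kernel *)

Section Conv.
Context {R : realType}.
Local Notation mu := (@lebesgue_measure R).

Definition rl_conv (a : R) (w : R -> R) (t : R) : R :=
  \int[mu]_s (rl_kernel a (t - s) * w s).

Lemma measurable_rl_convE a (w : R -> R) : measurable_fun setT w -> (forall s, 0 <= w s) ->
  measurable_fun setT (fun t : R => \int[mu]_s (rl_kernel a (t - s) * w s)%:E)%E.
Proof.
move=> mw w0.
pose F (p : measurableTypeR R * measurableTypeR R) : \bar R :=
  (rl_kernel a (p.1 - p.2) * w p.2)%:E.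
have mF : measurable_fun setT F.
  apply/measurable_EFinP; apply: measurable_funM; last exact: measurableT_comp.
  by apply: (measurableT_comp (measurable_rl_kernel a)); exact: measurable_funB.
apply: (@measurable_fun_fubini_tonelli_F _ _ _ _ _ mu F mF) => p.
by rewrite lee_fin mulr_ge0 ?rl_kernel_ge0.
Qed.

Lemma rl_conv_bounded a M (w : R -> R) t : 0 < a -> 0 <= t ->
  measurable_fun setT w -> (forall s, 0 <= w s <= M) ->
  (forall s, s < 0 -> w s = 0) ->
  (\int[mu]_s (rl_kernel a (t - s) * w s)%:E <= (M * (t `^ a / a))%:E)%E.
Proof.
move=> a0 t0 mw wM ws0.
have M0 : 0 <= M by have /andP[] := wM 0; exact: le_trans.
apply: (@le_trans _ _ (\int[mu]_s (M%:E * ((rl_kernel a \_ `[0%R, t]) (t - s))%:E))%E).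
  have mp : measurable_fun setT (fun s : R => (rl_kernel a \_ `[0%R, t]) (t - s)).
    apply: (measurableT_comp (measurable_patchT _ (measurable_rl_kernel a))) => //.
    exact: measurable_funB.
  apply: ge0_le_integral => //.
  - move=> s _; rewrite lee_fin mulr_ge0 ?rl_kernel_ge0//.
    by case/andP : (wM s).
  - apply/measurable_EFinP; apply: measurable_funM => //.
    exact: measurable_rl_kernelB.
  - by apply/measurable_EFinP; apply: measurable_funM.
  - move=> s _; rewrite lee_fin patchE mem_setE in_itv/= subr_ge0.
    have [s0|s0] := ltP s 0.
      rewrite ws0// mulr0 mulr_ge0//; case: ifP => // _; exact: rl_kernel_ge0.
    have [st|st] := leP s t.
      rewrite lerBlDr lerDl s0/= mulrC ler_wpM2r ?rl_kernel_ge0//.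
      by case/andP : (wM s).
    by rewrite /= rl_kernel_lt0 ?subr_lt0// mul0r mulr0.
rewrite ge0_integralZl//.
- rewrite -(@ge0_integral_reflect _ t (fun s => ((rl_kernel a \_ `[0%R, t]) s)%:E)%E).
  + by rewrite integral_rl_kernel_patch// -EFinM.
  + by apply/measurable_EFinP; apply: measurable_patchT => //; exact: measurable_rl_kernel.
  + by move=> s; rewrite lee_fin patchE; case: ifP => // _; exact: rl_kernel_ge0.
- apply/measurable_EFinP.
  apply: (measurableT_comp (measurable_patchT _ (measurable_rl_kernel a))) => //.
  exact: measurable_funB.
- by move=> s _; rewrite lee_fin patchE; case: ifP => // _; exact: rl_kernel_ge0.
Qed.

Lemma rl_conv_before a t1 (w : R -> R) t : (forall s, s < t1 -> w s = 0) ->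
  t < t1 -> (\int[mu]_s (rl_kernel a (t - s) * w s)%:E = 0)%E.
Proof.
move=> w0 tt1; rewrite integral0_eq// => s _.
have [s1|s1] := ltP s t1; first by rewrite w0// mulr0.
by rewrite rl_kernel_lt0 ?mul0r// subr_lt0 (lt_le_trans tt1).
Qed.

Lemma rl_convE a M (w : R -> R) t : 0 < a ->
  measurable_fun setT w -> (forall s, 0 <= w s <= M) ->
  (forall s, s < 0 -> w s = 0) ->
  (\int[mu]_s (rl_kernel a (t - s) * w s)%:E = (rl_conv a w t)%:E)%E.
Proof.
move=> a0 mw wM ws0; rewrite /rl_conv /Rintegral fineK//.
have [t0|t0] := ltP t 0; first by rewrite (rl_conv_before a ws0 t0).
rewrite ge0_fin_numE.
  by apply: le_lt_trans (ltry _); exact: (rl_conv_bounded a0 t0 mw wM ws0).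
apply: integral_ge0 => s _; rewrite lee_fin mulr_ge0 ?rl_kernel_ge0//.
by case/andP : (wM s).
Qed.

Lemma rl_conv_ge0 a (w : R -> R) t : (forall s, 0 <= w s) -> 0 <= rl_conv a w t.
Proof.
by move=> w0; apply: Rintegral_ge0 => s _; rewrite mulr_ge0 ?rl_kernel_ge0.
Qed.

(** A function with slope at least c on [t1, t0] keeps a positive slope after
    fractional integration: in the form where the kernel is evaluated at s and the
    function at t - s, shifting t0 by h costs at least c h for each s <= L, where
    both arguments stay in [t1, t0], and nothing for the other s. *)
Lemma le_integral_rl_kernel_shift a c h L t0 t1 (G : R -> R) :
  0 < a -> 0 <= c -> 0 <= h <= L -> t1 + L *+ 2 <= t0 ->
  measurable_fun setT G -> (forall s, 0 <= G s) ->
  (forall s, s < t1 -> G s = 0) ->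
  (forall s t, t1 <= s -> s <= t -> t <= t0 -> c * (t - s) <= G t - G s) ->
  (\int[mu]_s ((rl_kernel a s)%:E * (G (t0 - h - s))%:E) + (c * h * (L `^ a / a))%:E
   <= \int[mu]_s ((rl_kernel a s)%:E * (G (t0 - s))%:E))%E.
Proof.
move=> a0 c0 /andP[h0 hL] t1L mG G0 G_before inc.
have L0 := le_trans h0 hL.
have mka : measurable_fun setT (fun s : R => (rl_kernel a s)%:E).
  by apply/measurable_EFinP; exact: measurable_rl_kernel.
have mGB t : measurable_fun setT (fun s : R => (G (t - s))%:E).
  apply/measurable_EFinP; apply: (measurableT_comp mG).
  exact: measurable_funB.
pose q := rl_kernel a \_ `[0%R, L].
have mq : measurable_fun setT q.
  by apply: measurable_patchT => //; exact: measurable_rl_kernel.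
have qE s : q s = if 0 <= s <= L then rl_kernel a s else 0.
  by rewrite /q patchE mem_setE in_itv.
have iq : (\int[mu]_s (q s)%:E = (L `^ a / a)%:E)%E.
  exact: integral_rl_kernel_patch.
have k0 s : 0 <= rl_kernel a s := rl_kernel_ge0 a s.
have kN s : s < 0 -> rl_kernel a s = 0 by exact: rl_kernel_lt0.
move: (rl_kernel a) q mka mq qE iq k0 kN => k q mka mq qE iq k0 kN.
have q0 s : 0 <= q s by rewrite qE; case: ifP.
have mcq : measurable_fun setT (fun s : R => (c * h)%:E * (q s)%:E)%E.
  by apply: emeasurable_funM => //; exact/measurable_EFinP.
rewrite EFinM -iq -ge0_integralZl//; last 3 first.
- exact/measurable_EFinP.
- by move=> s _; rewrite lee_fin q0.
- by rewrite lee_fin mulr_ge0.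
rewrite -ge0_integralD//; last 3 first.
- by move=> s _; rewrite -EFinM lee_fin mulr_ge0.
- exact: (emeasurable_funM mka (mGB _)).
- by move=> s _; rewrite -EFinM lee_fin !mulr_ge0.
apply: ge0_le_integral => //.
- by move=> s _; rewrite adde_ge0// -EFinM lee_fin !mulr_ge0.
- exact: (emeasurable_funD (emeasurable_funM mka (mGB _)) mcq).
- exact: (emeasurable_funM mka (mGB t0)).
move=> s _; rewrite -!EFinM -EFinD lee_fin qE.
have [s0|s0] := ltP s 0; first by rewrite (kN _ s0)/= !mul0r mulr0 addr0.
rewrite /=; have [st|st] := ltP (t0 - h - s) t1.
  rewrite G_before// mulr0 add0r; case: ifPn => sL; last by rewrite mulr0 mulr_ge0.
  by exfalso; move: st hL sL t1L; rewrite mulr2n; lra.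
have := inc (t0 - h - s) (t0 - s) st.
have -> : t0 - s - (t0 - h - s) = h by ring.
have -> : t0 - h - s <= t0 - s by lra.
have -> : t0 - s <= t0 by lra.
move=> /(_ isT isT) hc.
have ch0 : 0 <= c * h by rewrite mulr_ge0.
case: ifPn => sL.
  by rewrite (mulrC (c * h)) -mulrDr ler_wpM2l// -lerBrDl.
by rewrite mulr0 addr0 ler_wpM2l// -subr_ge0 (le_trans _ hc).
Qed.

(** Abel inversion in the form of an inequality: if the fractional integral of
    w >= 0 has slope at least c up to t0, then w does not tend to 0 at t0.  Indeed
    one more fractional integration yields a multiple of the primitive of w, which
    would then have slope bounded below as well. *)
Lemma rl_conv_increase_pos b c M t1 t0 (w : R -> R) : 0 < b < 1 -> 0 < c ->
  0 <= t1 -> t1 < t0 ->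
  measurable_fun setT w -> (forall s, 0 <= w s <= M) ->
  (forall s, s < t1 -> w s = 0) ->
  (forall s t, t1 <= s -> s <= t -> t <= t0 ->
    c * (t - s) <= rl_conv b w t - rl_conv b w s) ->
  exists2 e, 0 < e & forall d, 0 < d -> d <= t0 - t1 ->
    exists2 s, t0 - d <= s < t0 & e < w s.
Proof.
move=> /andP[b0 b1] c0 t10 t1t0 mw wM w0 inc.
have w_ge0 s : 0 <= w s by case/andP : (wM s).
have w00 s : s < 0 -> w s = 0 by move=> s0; rewrite w0// (lt_le_trans s0).
pose a := 1 - b; have a01 : 0 < a < 1 by rewrite /a; apply/andP; split; lra.
have a0 : 0 < a by case/andP : a01.
have bE : 1 - a = b by rewrite /a; ring.
pose L := (t0 - t1) / 2; have L0 : 0 < L by rewrite divr_gt0// subr_gt0.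
pose K := L `^ a / a; have K0 : 0 < K by rewrite divr_gt0// powR_gt0.
have k0 : 0 < beta_const a by exact: beta_const_gt0.
(* with w <= e near t0, the primitive of w gains at most half of what is needed *)
pose e := c * K / (beta_const a * 2).
have e0 : 0 < e by rewrite divr_gt0// mulr_gt0.
exists e => // d d0 dt; apply/not_exists2P => nex.
have we s : t0 - d <= s < t0 -> w s <= e.
  by move=> sd; case: (nex s) => // /negP; rewrite -leNgt.
pose h := Num.min d L.
have h0 : 0 < h by rewrite lt_min d0 L0.
have hL : h <= L by rewrite ge_min lexx orbT.
have hd : h <= d by rewrite ge_min lexx.
pose P t := (\int[mu]_s ((rl_kernel a (t - s))%:E * (rl_conv b w s)%:E))%E.
have PE t : P t = ((beta_const a)%:E * \int[mu]_(r in `]-oo, t[) (w r)%:E)%E.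
  rewrite -rl_kernel_convol// bE; apply: eq_integral => s _.
  by rewrite (rl_convE _ b0 mw wM w00).
have mconv : measurable_fun setT (fun s : R => (rl_conv b w s)%:E).
  rewrite (_ : (fun s : R => (rl_conv b w s)%:E) =
      (fun s => \int[mu]_r (rl_kernel b (s - r) * w r)%:E)%E).
    exact: measurable_rl_convE.
  by apply/funext => s; rewrite (rl_convE _ b0 mw wM w00).
have mconvB t : measurable_fun setT (fun s : R => (rl_conv b w (t - s))%:E).
  by apply: (measurableT_comp mconv); exact: measurable_funB.
have mka : measurable_fun setT (fun s : R => (rl_kernel a s)%:E).
  by apply/measurable_EFinP; exact: measurable_rl_kernel.
have mkaB t : measurable_fun setT (fun s : R => (rl_kernel a (t - s))%:E).
  by apply/measurable_EFinP; exact: measurable_rl_kernelB.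
have PE' t : P t = (\int[mu]_s ((rl_kernel a s)%:E * (rl_conv b w (t - s))%:E))%E.
  pose f s := ((rl_kernel a (t - s))%:E * (rl_conv b w s)%:E)%E.
  transitivity (\int[mu]_s f (t - s)%R)%E.
    apply: ge0_integral_reflect.
    - exact: (emeasurable_funM (mkaB t) mconv).
    - by move=> s; rewrite /f -EFinM lee_fin mulr_ge0 ?rl_kernel_ge0 ?rl_conv_ge0.
  by apply: eq_integral => s _; rewrite /f subKr.
have conv0 s : s < t1 -> rl_conv b w s = 0.
  by move=> st; rewrite /rl_conv /Rintegral (rl_conv_before b w0 st).
have low : (P (t0 - h)%R + (c * h * K)%:E <= P t0)%E.
  rewrite !PE'; apply: (@le_integral_rl_kernel_shift _ _ _ _ _ t1) => //.
  - exact: ltW.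
  - by rewrite hL ltW.
  - by rewrite /L mulr2n; lra.
  - exact/measurable_EFinP.
  - by move=> s; exact: rl_conv_ge0.
have mwE A : measurable_fun A (fun r => (w r)%:E).
  by apply/measurable_EFinP/measurable_funTS.
have up : (P t0 <= P (t0 - h)%R + (beta_const a * (e * h))%:E)%E.
  rewrite !PE; have -> : `]-oo, t0[%classic = `]-oo, (t0 - h)%R[ `|` `[(t0 - h)%R, t0[.
    by rewrite -itv_bndbnd_setU ?bnd_simp//; lra.
  rewrite ge0_integral_setU//=; last 3 first.
  - exact: mwE.
  - by move=> r _; rewrite lee_fin.
  - apply/disj_set2P; rewrite -subset0 => r/=; rewrite !in_itv/= => -[r1 /andP[r2 _]].
    by move: r1; rewrite ltNge r2.
  rewrite ge0_muleDr ?integral_ge0//; try by move=> r _; rewrite lee_fin.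
  rewrite leeD2l// EFinM; apply: lee_wpmul2l; first by rewrite lee_fin ltW.
  have <- : (\int[mu]_(r in `[(t0 - h)%R, t0[) e%:E = (e * h)%:E)%E.
    rewrite integral_cst//= lebesgue_measure_itv/= lte_fin ltrBlDr ltrDl h0.
    by rewrite -EFinD subKr.
  apply: ge0_le_integral => //.
  - by move=> r _; rewrite lee_fin.
  - exact: mwE.
  - move=> r /=; rewrite in_itv/= => /andP[r1 r2]; rewrite lee_fin we// r2 andbT.
    by rewrite (le_trans _ r1)// lerB.
have fin : P (t0 - h) \is a fin_num.
  rewrite PE fin_numM// ge0_fin_numE; last first.
    by apply: integral_ge0 => r _; rewrite lee_fin.
  have M0 : 0 <= M by case/andP : (wM 0); exact: le_trans.
  apply: (@le_lt_trans _ _ (\int[mu]_(r in `[0%R, t0]) M%:E)%E); last first.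
    rewrite integral_cst//= lebesgue_measure_itv/=.
    by case: ifP => _; rewrite -?EFinD -?EFinM ?mule0 ltry.
  rewrite integral_mkcond [leRHS]integral_mkcond; apply: ge0_le_integral => //.
  - by move=> r _; rewrite patchE; case: ifP => // _; rewrite lee_fin.
  - by apply: (iffLR (measurable_restrictT _ _)) => //; exact: mwE.
  - by apply: (iffLR (measurable_restrictT _ _)).
  - move=> r _; rewrite !patchE !mem_setE !in_itv/=.
    case: ifPn => [rt|_]; last by case: ifPn => // _; rewrite lee_fin.
    case: ifPn => [_|]; first by rewrite lee_fin; case/andP : (wM r).
    rewrite negb_and -!ltNge => /orP[r0|]; first by rewrite w00.
    by move=> r0; exfalso; move: rt r0 h0; lra.
have := le_trans low up; rewrite leeD2lE// lee_fin => bad.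
have : c * h * K < c * h * K; last by rewrite ltxx.
apply: (le_lt_trans bad).
have -> : beta_const a * (e * h) = c * K * h / 2.
  by rewrite /e; field; rewrite (gt_eqF k0).
have ckh0 : 0 < c * K * h by rewrite mulr_gt0// mulr_gt0.
have -> : c * h * K = c * K * h by ring.
lra.
Qed.

End Conv.

(** * Continuity and derivatives relative to an interval *)

Section WithinContinuity.
Context {R : realType}.

Lemma within_continuousE (a b : R) (u : R -> R) :
  {within `[a, b], continuous u} <->
  (forall x, a <= x <= b -> forall e, 0 < e -> exists2 d, 0 < d &
     forall y, a <= y <= b -> `|y - x| < d -> `|u y - u x| < e).
Proof.
rewrite subspace_continuousP; split=> [uc x xab e e0|uc x /=].
  have xab' : `[a, b]%classic x by rewrite /= in_itv.
  have /cvgrPdist_lt/(_ e e0) := uc x xab'.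
  rewrite near_withinE => /nbhs_ballP[d /= d0 dP]; exists d => // y yab yx.
  rewrite distrC; apply: dP; first by rewrite /ball/= distrC.
  by rewrite /= in_itv.
rewrite in_itv/= => xab; apply/cvgrPdist_lt => e e0.
have [d d0 dP] := uc x xab e e0.
rewrite near_withinE; apply/nbhs_ballP; exists d => //= y yx.
rewrite in_itv/= => yab; rewrite distrC; apply: dP => //.
by move: yx; rewrite /ball/= distrC.
Qed.

Lemma within_continuous_bounded (a b : R) (u : R -> R) :
  {within `[a, b], continuous u} ->
  exists2 M, 0 <= M & forall s, a <= s <= b -> `|u s| <= M.
Proof.
move=> uc; have [M [Mr MP]] :=
  compact_bounded (continuous_compact uc (@segment_compact R a b)).
exists (`|M| + 1); first by rewrite addr_ge0.
move=> s sab; apply: MP; first by rewrite (le_lt_trans (ler_norm _))// ltrDl.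
by exists s => //=; rewrite in_itv.
Qed.

Lemma is_derive_onP T (F : R -> R) t l : is_derive_on T F t l <->
  (forall e, 0 < e -> exists2 d, 0 < d & forall s, 0 <= s <= T -> s != t ->
    `|s - t| < d -> `|(F s - F t) / (s - t) - l| < e).
Proof.
rewrite /is_derive_on; split=> [/cvgrPdist_lt h e e0|h].
  have := h e e0; rewrite near_withinE near_withinE => /nbhs_ballP[d /= d0 dP].
  exists d => // s sT st std; rewrite distrC.
  apply: dP; [by rewrite /ball/= distrC|by []|by rewrite /= in_itv].
apply/cvgrPdist_lt => e e0; have [d d0 dP] := h e e0.
rewrite near_withinE near_withinE; apply/nbhs_ballP; exists d => //= s std st.
rewrite in_itv/= => sT; rewrite distrC; apply: dP => //.
by move: std; rewrite /ball/= distrC.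
Qed.

Lemma is_derive_on_interior T (F : R -> R) x l : 0 < x < T ->
  is_derive_on T F x l -> is_derive x 1 F l.
Proof.
move=> /andP[x0 xT] /is_derive_onP h.
have lim : (fun h => h^-1 *: ((F \o shift x) (h *: 1) - F x)) @ 0^' --> l.
  apply/cvgrPdist_lt => e e0; have [d d0 dP] := h e e0.
  rewrite near_withinE; apply/nbhs_ballP.
  exists (Num.min d (Num.min x (T - x))).
    by rewrite /= !lt_min d0 x0 subr_gt0.
  move=> k; rewrite /ball/= sub0r normrN !lt_min => /and3P[kd kx kT] k0.
  rewrite distrC; have := dP (k + x).
  have -> : k + x - x = k by ring.
  rewrite mulrC /GRing.scale/= mulr1; apply => //.
    by move: kx kT; rewrite !ltr_norml => /andP[? ?] /andP[? ?]; lra.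
  by apply: contra k0 => /eqP kx0; apply/eqP; lra.
by apply: DeriveDef; [apply/cvg_ex; exists l|exact: cvg_lim].
Qed.

Lemma is_derive_on_continuous T (F : R -> R) x l : is_derive_on T F x l ->
  forall e, 0 < e -> exists2 d, 0 < d &
    forall y, 0 <= y <= T -> `|y - x| < d -> `|F y - F x| < e.
Proof.
move=> /is_derive_onP h e e0; have [d d0 dP] := h 1 ltr01.
have l0 : 0 < `|l| + 1 by rewrite ltr_wpDl.
exists (Num.min d (e / (`|l| + 1))); first by rewrite lt_min d0 divr_gt0.
move=> y yT; rewrite lt_min => /andP[yd ye].
have [->|yx] := eqVneq y x; first by rewrite subrr normr0.
have yx0 : 0 < `|y - x| by rewrite normr_gt0 subr_eq0.
have q : `|(F y - F x) / (y - x)| < `|l| + 1.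
  have := dP y yT yx yd; set q := (F y - F x) / _ => ql.
  by rewrite -(subrK l q) (le_lt_trans (ler_normD _ _))// addrC ltrD2l.
move: q; rewrite normrM normfV ltr_pdivrMr// => q.
by rewrite (lt_le_trans q)// mulrC -ler_pdivlMr// ltW.
Qed.

(** The mean value theorem for [is_derive_on].  The interval may end at T, where
    only the continuity of F matters. *)
Lemma is_derive_on_increase T (F H : R -> R) c t1 t0 : 0 < t1 -> t0 <= T ->
  (forall t, t1 <= t <= t0 -> is_derive_on T F t (H t)) ->
  (forall t, t1 <= t <= t0 -> c <= H t) ->
  forall s t, t1 <= s -> s <= t -> t <= t0 -> c * (t - s) <= F t - F s.
Proof.
move=> t10 t0T FH cH s t t1s st tt0.
have [x||x xst ->] := @MVT_segment R F H s t st.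
- rewrite in_itv/= => /andP[sx xt]; apply: (@is_derive_on_interior T).
    by apply/andP; split; lra.
  by apply: FH; apply/andP; split; lra.
- apply/within_continuousE => x /andP[sx xt] e e0.
  have [|d d0 dP] := @is_derive_on_continuous T F x (H x) _ e e0.
    by apply: FH; apply/andP; split; lra.
  by exists d => // y /andP[sy yt]; apply: dP; apply/andP; split; lra.
- by move: xst; rewrite in_itv/= => /andP[sx xt]; rewrite ler_wpM2r ?subr_ge0// cH//;
    apply/andP; split; lra.
Qed.

End WithinContinuity.

(** * Fractional integrals of continuous functions *)

Section FracInt.
Context {R : realType}.
Local Notation mu := (@lebesgue_measure R).

Lemma frac_int_eq a (u v : R -> R) t : 0 <= t ->
  (forall s, 0 <= s <= t -> u s = v s) -> frac_int a u t = frac_int a v t.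
Proof.
move=> t0 uv; rewrite /frac_int uv ?t0 ?lexx//; case: ifP => // _.
congr (_ * _); apply: eq_Rintegral => s; rewrite inE/= in_itv/= => st.
by rewrite uv.
Qed.

(** The fractional integral of a continuous function is a genuine integral; without
    this, [frac_int] need not be linear. *)
Lemma frac_int_integrable a (u : R -> R) t : 0 < a -> 0 <= t ->
  {within `[0, t], continuous u} ->
  mu.-integrable `[0, t] (EFin \o (fun s => (t - s) `^ (a - 1) * u s)).
Proof.
move=> a0 t0 uc; have [M M0 uM] := within_continuous_bounded uc.
have mu_ : measurable_fun `[0, t] u by exact: subspace_continuous_measurable_fun.
have mk : measurable_fun `[0, t] (fun s : R => (t - s) `^ (a - 1)).
  apply: measurable_funTS; apply: (measurableT_comp (measurable_powR (a - 1))).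
  exact: measurable_funB.
apply: (@integrableMl _ _ _ mu _ _ (fun s => ((t - s) `^ (a - 1))%:E) u) => //.
- apply/integrableP; split; first exact/measurable_EFinP.
  apply: (@le_lt_trans _ _ (t `^ a / a)%:E); last exact: ltry.
  rewrite -integral_rl_kernel_patch//.
  rewrite (@ge0_integral_reflect _ t); last 2 first.
  - by apply/measurable_EFinP; apply: measurable_patchT => //; exact: measurable_rl_kernel.
  - by move=> s; rewrite lee_fin patchE; case: ifP => // _; exact: rl_kernel_ge0.
  rewrite integral_mkcond le_eqVlt; apply/orP; left; apply/eqP.
  apply: eq_integral => s _; rewrite !patchE !mem_setE !in_itv/=.
  rewrite subr_ge0 lerBlDr lerDl andbC; case: ifPn => // /andP[st s0].
  by rewrite ger0_norm ?powR_ge0// /rl_kernel subr_ge0 st.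
- exists M; split; first exact: num_real.
  move=> x Mx s /=; rewrite in_itv/= => st; exact: le_trans (uM s st) (ltW Mx).
Qed.

Lemma frac_int_lin a (u v : R -> R) c t : 0 <= a -> 0 <= t ->
  {within `[0, t], continuous u} -> {within `[0, t], continuous v} ->
  frac_int a (fun s => u s + c * v s) t = frac_int a u t + c * frac_int a v t.
Proof.
move=> a_ge0 t0 uc vc; rewrite /frac_int; case: eqVneq => // a_neq0.
have a0 : 0 < a by rewrite lt_neqAle eq_sym a_neq0.
have iu := frac_int_integrable a0 t0 uc.
have iv := frac_int_integrable a0 t0 vc.
rewrite mulrCA -mulrDr; congr (_ * _).
rewrite -RintegralZl// -RintegralD//.
- by apply: eq_Rintegral => s _; ring.
- exact: (@integrableZl _ _ _ mu _ (measurable_itv `[0, t]) c _ iv).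
Qed.

Lemma frac_int_rl_conv a (u : R -> R) t t0 : 0 < a -> t <= t0 ->
  frac_int a u t = (euler_Gamma a)^-1 * rl_conv a (u \_ `[0, t0]) t.
Proof.
move=> a0 tt0; rewrite /frac_int gt_eqF//; congr (_ * _).
rewrite /rl_conv Rintegral_mkcond; apply: eq_Rintegral => s _.
rewrite !patchE !mem_setE !in_itv/=.
have [s0|s0] := leP 0 s; last by rewrite mulr0.
have [st|st] := leP s t; first by rewrite (le_trans st tt0) /rl_kernel subr_ge0 st.
by rewrite rl_kernel_lt0 ?subr_lt0// mul0r.
Qed.

Lemma frac_int_cst1 (a t : R) : 0 < a -> 0 <= t ->
  frac_int a (fun=> 1) t = (euler_Gamma a)^-1 * (t `^ a / a).
Proof.
move=> a0 t0; rewrite (frac_int_rl_conv _ a0 (lexx t)); congr (_ * _).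
apply: EFin_inj; rewrite -integral_rl_kernel_patch//.
rewrite -(@rl_convE _ a 1) //.
- rewrite [RHS](@ge0_integral_reflect _ t).
  + apply: eq_integral => s _; congr EFin.
    rewrite !patchE !mem_setE !in_itv/= subr_ge0 lerBlDr lerDl andbC.
    by case: ifP => _; rewrite ?mulr1// mulr0.
  + by apply/measurable_EFinP; apply: measurable_patchT => //; exact: measurable_rl_kernel.
  + by move=> s; rewrite lee_fin patchE; case: ifP => // _; exact: rl_kernel_ge0.
- exact: measurable_patchT.
- by move=> s; rewrite patchE; case: ifP => _; rewrite ?lexx ler01.
- by move=> s s0; rewrite patchE mem_setE in_itv/= leNgt s0.
Qed.

End FracInt.

(** * A fractional extremum principle *)

Section Extremum.
Context {R : realType}.
Local Notation mu := (@lebesgue_measure R).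

Lemma rl_convD a M (w1 w2 : R -> R) t : 0 < a ->
  measurable_fun setT w1 -> measurable_fun setT w2 ->
  (forall s, 0 <= w1 s <= M) -> (forall s, 0 <= w2 s <= M) ->
  (forall s, s < 0 -> w1 s = 0) -> (forall s, s < 0 -> w2 s = 0) ->
  rl_conv a (fun s => w1 s + w2 s) t = rl_conv a w1 t + rl_conv a w2 t.
Proof.
move=> a0 m1 m2 b1 b2 z1 z2; apply: EFin_inj; rewrite EFinD.
rewrite -(rl_convE _ a0 m1 b1 z1) -(rl_convE _ a0 m2 b2 z2).
rewrite -(@rl_convE _ a (M + M)) //; last 3 first.
- exact: measurable_funD.
- move=> s; have /andP[? ?] := b1 s; have /andP[? ?] := b2 s.
  by apply/andP; split; lra.
- by move=> s s0; rewrite z1// z2// addr0.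
rewrite -ge0_integralD//.
- by apply: eq_integral => s _; rewrite mulrDr.
- by move=> s _; rewrite lee_fin mulr_ge0 ?rl_kernel_ge0//; case/andP : (b1 s).
- by apply/measurable_EFinP; apply: measurable_funM => //; exact: measurable_rl_kernelB.
- by move=> s _; rewrite lee_fin mulr_ge0 ?rl_kernel_ge0//; case/andP : (b2 s).
- by apply/measurable_EFinP; apply: measurable_funM => //; exact: measurable_rl_kernelB.
Qed.

(** The contribution of the past decreases with time, as the kernel does. *)
Lemma rl_conv_nincr a M t1 (w : R -> R) s t : 0 < a <= 1 ->
  measurable_fun setT w -> (forall r, 0 <= w r <= M) ->
  (forall r, r < 0 -> w r = 0) -> (forall r, t1 <= r -> w r = 0) ->
  t1 <= s -> s <= t -> rl_conv a w t <= rl_conv a w s.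
Proof.
move=> /andP[a0 a1] mw b z0 z1 t1s st.
suff : (\int[mu]_r (rl_kernel a (t - r) * w r)%:E <=
        \int[mu]_r (rl_kernel a (s - r) * w r)%:E)%E.
  by rewrite (rl_convE t a0 mw b z0) (rl_convE s a0 mw b z0) lee_fin.
apply: ge0_le_integral => //.
- by move=> r _; rewrite lee_fin mulr_ge0 ?rl_kernel_ge0//; case/andP : (b r).
- by apply/measurable_EFinP; apply: measurable_funM => //; exact: measurable_rl_kernelB.
- by apply/measurable_EFinP; apply: measurable_funM => //; exact: measurable_rl_kernelB.
move=> r _; rewrite lee_fin; have [r1|r1] := leP t1 r; first by rewrite z1// !mulr0.
rewrite ler_wpM2r//; first by case/andP : (b r).
by apply: rl_kernel_nincr => //; lra.
Qed.

Lemma frac_int0 (u : R -> R) : frac_int 0 u = u.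
Proof. by apply/funext => t; rewrite /frac_int eqxx. Qed.

(** If H t0 > 0, then I^(1-a) (u - u 0) has slope at least c > 0 on some [t1, t0].
    Of its three contributions, the one of u on [0, t1[ and the one of the constant
    - u 0 are nonincreasing on [t1, t0].  Hence the contribution of u on [t1, t0]
    has slope at least c, which is incompatible with u t0 = 0.  For a = 1 the
    fractional integral is u - u 0 itself, and u would increase up to its minimum. *)
Lemma caputo_le0_at_zero_min T a t0 (u H : R -> R) : 0 < a <= 1 ->
  0 < t0 <= T ->
  {within `[0, T], continuous u} -> {within `[0, T], continuous H} ->
  (forall t, 0 < t <= T -> is_caputo T a u t (H t)) ->
  (forall s, 0 <= s <= t0 -> 0 <= u s) -> u t0 = 0 -> H t0 <= 0.
Proof.
move=> /andP[a0 a1] /andP[t00 t0T] uc Hc uH u0 ut0; rewrite leNgt; apply/negP => H0.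
have t0in : 0 <= t0 <= T by rewrite ltW.
pose c := H t0 / 2; have c0 : 0 < c by rewrite divr_gt0.
have [d d0 dP] := (within_continuousE 0 T H).1 Hc t0 t0in c c0.
pose t1 := Num.max (t0 - d / 2) (t0 / 2).
have t10 : 0 < t1 by rewrite lt_max divr_gt0// orbT.
have t1t0 : t1 < t0 by rewrite gt_max; apply/andP; split; lra.
have t1d : t0 - d / 2 <= t1 by rewrite le_max lexx.
have cH t : t1 <= t <= t0 -> c <= H t.
  move=> /andP[t1t tt0]; have := dP t.
  rewrite (@ler0_norm _ (t - t0)) ?subr_le0//.
  have -> : 0 <= t <= T by apply/andP; split; lra.
  have -> : - (t - t0) < d by lra.
  by move=> /(_ isT isT); rewrite ltr_norml => /andP[+ _]; rewrite /c; lra.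
pose F := frac_int (1 - a) (fun s => u s - u 0).
have inc s t : t1 <= s -> s <= t -> t <= t0 -> c * (t - s) <= F t - F s.
  apply: (@is_derive_on_increase _ T F H) => // r /andP[t1r rt0].
  by apply: uH; apply/andP; split; lra.
have u00 : 0 <= u 0 by apply: u0; rewrite lexx ltW.
have ut1 : 0 <= u t1 by apply: u0; rewrite !ltW.
have [a1E|a_neq1] := eqVneq a 1.
  have FE t : F t = u t - u 0.
    by rewrite /F (_ : 1 - a = 0) ?frac_int0// a1E subrr.
  have := inc t1 t0 (lexx _) (ltW t1t0) (lexx _).
  have : 0 < c * (t0 - t1) by rewrite mulr_gt0// subr_gt0.
  by rewrite !FE ut0; clear -ut1; lra.
pose b := 1 - a.
have b01 : 0 < b < 1 by rewrite /b subr_gt0 lt_neqAle a_neq1 a1/=; lra.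
have /andP[b0 b1] := b01.
have [M M0 uM] := within_continuous_bounded uc.
have mu_ : measurable_fun `[0, T] u by exact: subspace_continuous_measurable_fun.
have mP (A : set R) : measurable A -> A `<=` `[0, T] -> measurable_fun setT (u \_ A).
  move=> mA AT; apply: (iffLR (measurable_restrictT _ mA)).
  exact: measurable_funS mu_.
have bP (A : set R) : A `<=` `[0, t0] -> forall s, 0 <= (u \_ A) s <= M.
  move=> AT s; rewrite patchE; case: ifPn => [|_]; last by rewrite lexx.
  rewrite inE => /AT/=; rewrite in_itv/= => /andP[s0 st]; rewrite u0 ?s0//=.
  by rewrite (le_trans (ler_norm _))// uM// s0 (le_trans st).
have zP (A : set R) : A `<=` `[0, t0] -> forall s, s < 0 -> (u \_ A) s = 0.
  move=> AT s s0; rewrite patchE; case: ifPn => // /[!inE] /AT/=.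
  by rewrite in_itv/= => /andP[s0' _]; move: s0; rewrite ltNge s0'.
have A1 : `[0, t1[ `<=` `[0, t0].
  by move=> s /=; rewrite !in_itv/= => /andP[-> st]; rewrite ltW// (lt_trans st).
have A2 : `[t1, t0] `<=` `[0, t0].
  by move=> s /=; rewrite !in_itv/= => /andP[st ->]; rewrite andbT (le_trans _ st)// ltW.
have A0 : `[0, t0] `<=` `[0, T].
  by move=> s /=; rewrite !in_itv/= => /andP[-> st]; rewrite (le_trans st).
(* t1 belongs to the second piece, so that the kernel is only evaluated at positive
   arguments on the first one, where it is monotone *)
pose w1 := u \_ `[0, t1[; pose w2 := u \_ `[t1, t0].
have mw1 : measurable_fun setT w1 by apply: mP => //; exact: subset_trans A1 A0.
have mw2 : measurable_fun setT w2 by apply: mP => //; exact: subset_trans A2 A0.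
have G0 : 0 < euler_Gamma b by apply: euler_Gamma_gt0 => //; exact: ltW.
have FE t : 0 <= t <= t0 -> euler_Gamma b * F t =
    rl_conv b w1 t + rl_conv b w2 t - u 0 * (t `^ b / b).
  move=> /andP[tge0 tt0].
  have ct : {within `[0, t], continuous u}.
    apply: continuous_subspaceW uc => s /=; rewrite !in_itv/= => /andP[-> st].
    by rewrite (le_trans st)// (le_trans tt0).
  have -> : F t = frac_int b (fun s => u s + (- u 0) * 1) t.
    by congr frac_int; apply/funext => s; rewrite mulr1.
  rewrite (@frac_int_lin _ b u (fun=> 1))//; last 2 first.
  - exact: ltW.
  - by move=> x; exact: cvg_cst.
  rewrite frac_int_cst1// (frac_int_rl_conv _ b0 tt0).
  have -> : u \_ `[0, t0] = (fun s => w1 s + w2 s).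
    apply/funext => s; rewrite /w1 /w2 !patchE !mem_setE !in_itv/=.
    have [s0|s0] := leP 0 s; have [st1|st1] := ltP s t1;
      have [st|st] := leP s t0; rewrite /= ?addr0 ?add0r//;
      exfalso; clear -s0 st1 st t10 t1t0; lra.
  rewrite (rl_convD _ b0 mw1 mw2 (bP _ A1) (bP _ A2) (zP _ A1) (zP _ A2)).
  by field; rewrite !gt_eqF.
have w2b s : s < t1 -> w2 s = 0.
  by move=> st; rewrite /w2 patchE mem_setE in_itv/= leNgt st.
have w1a s : t1 <= s -> w1 s = 0.
  by move=> st; rewrite /w1 patchE mem_setE in_itv/= ltNge st andbF.
have [||e e0 eP] := @rl_conv_increase_pos R b (euler_Gamma b * c) M t1 t0 w2 b01 _
    (ltW t10) t1t0 mw2 (bP _ A2) w2b.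
- by rewrite mulr_gt0.
- move=> s t t1s st tt0.
  have s0 : 0 <= s by lra.
  have t_ge0 : 0 <= t by lra.
  have FG : euler_Gamma b * c * (t - s) <= euler_Gamma b * F t - euler_Gamma b * F s.
    by rewrite -mulrBr -mulrA ler_wpM2l ?(ltW G0)// inc.
  have N1 : rl_conv b w1 t <= rl_conv b w1 s.
    apply: (@rl_conv_nincr b M t1) => //; first by rewrite b0 ltW.
      exact: bP.
    exact: zP.
  have N2 : u 0 * (s `^ b / b) <= u 0 * (t `^ b / b).
    rewrite ler_wpM2l// ler_pM2r ?invr_gt0//.
    by apply: ge0_ler_powR => //; rewrite ?nnegrE// ltW.
  have tI : 0 <= t <= t0 by rewrite t_ge0.
  have sI : 0 <= s <= t0 by rewrite s0 (le_trans st).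
  rewrite (FE t tI) (FE s sI) in FG.
  move: FG N1 N2; generalize (rl_conv b w1 t) (rl_conv b w1 s) (rl_conv b w2 t)
    (rl_conv b w2 s) (u 0 * (s `^ b / b)) (u 0 * (t `^ b / b)).
  by clear; move=> *; lra.
have [d' d'0 d'P] := (within_continuousE 0 T u).1 uc t0 t0in e e0.
pose d2 := Num.min (d' / 2) (t0 - t1).
have d20 : 0 < d2 by rewrite lt_min subr_gt0 t1t0 divr_gt0.
have d2d : d2 <= d' / 2 by rewrite ge_min lexx.
have d2t : d2 <= t0 - t1 by rewrite ge_min lexx orbT.
have [s /andP[s1 s2] es] := eP d2 d20 d2t.
have := d'P s; rewrite ut0 subr0.
have -> : 0 <= s <= T by apply/andP; split; clear -s1 s2 d2t t10 t0T; lra.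
rewrite ltr0_norm ?subr_lt0//.
have -> : - (s - t0) < d' by clear -s1 d2d d'0; lra.
move=> /(_ isT isT); rewrite ltNge => /negP; apply.
rewrite (le_trans _ (ler_norm _))// ltW//.
move: es; rewrite /w2 patchE; case: ifP => // _ e00.
by exfalso; move: e00; rewrite ltNge ltW.
Qed.

End Extremum.

(** * Caputo derivatives of fractional integrals *)

Section CaputoAlgebra.
Context {R : realType}.

Lemma is_derive_on_eq T (F G : R -> R) t l : 0 <= t <= T ->
  (forall s, 0 <= s <= T -> F s = G s) ->
  is_derive_on T F t l -> is_derive_on T G t l.
Proof.
move=> tT FG /is_derive_onP h; apply/is_derive_onP => e e0.
by have [d d0 dP] := h e e0; exists d => // s sT; rewrite -!FG//; exact: dP.
Qed.

Lemma is_derive_on_lin T (F G : R -> R) c t l m :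
  is_derive_on T F t l -> is_derive_on T G t m ->
  is_derive_on T (fun s => F s + c * G s) t (l + c * m).
Proof.
rewrite /is_derive_on => Fl Gm.
have -> : (fun s => (F s + c * G s - (F t + c * G t)) / (s - t)) =
    (fun s => (F s - F t) / (s - t) + c * ((G s - G t) / (s - t))).
  by apply/funext => s; rewrite mulrA -mulrDl; congr (_ / _); ring.
by apply: cvgD => //; apply: cvgM => //; exact: cvg_cst.
Qed.

Lemma is_caputo_lin T a (u v : R -> R) c t l m : a <= 1 -> 0 <= t <= T ->
  {within `[0, T], continuous u} -> {within `[0, T], continuous v} ->
  is_caputo T a u t l -> is_caputo T a v t m ->
  is_caputo T a (fun s => u s + c * v s) t (l + c * m).
Proof.
move=> a1 tT uc vc ul vm; have := @is_derive_on_lin _ _ _ c _ _ _ ul vm.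
apply: is_derive_on_eq => // s /andP[s0 sT].
have sub : `[0, s] `<=` `[0, T].
  by move=> r /=; rewrite !in_itv/= => /andP[-> rs]; rewrite (le_trans rs).
rewrite -frac_int_lin ?subr_ge0//.
- by congr frac_int; apply/funext => r; ring.
- apply: continuous_subspaceW sub _; apply/within_continuousE => x xT e e0.
  have [d d0 dP] := (within_continuousE 0 T u).1 uc x xT e e0.
  exists d => // y yT yx; have -> : u y - u 0 - (u x - u 0) = u y - u x by ring.
  exact: dP.
- apply: continuous_subspaceW sub _; apply/within_continuousE => x xT e e0.
  have [d d0 dP] := (within_continuousE 0 T v).1 vc x xT e e0.
  exists d => // y yT yx; have -> : v y - v 0 - (v x - v 0) = v y - v x by ring.
  exact: dP.
Qed.

Lemma is_caputo_cst T a c t : 0 <= t <= T -> is_caputo T a (fun=> c : R) t 0.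
Proof.
move=> tT; apply: (@is_derive_on_eq T (fun=> 0)) => // [s sT|].
  rewrite /frac_int subrr; case: ifP => // _.
  under eq_Rintegral do rewrite mulr0.
  by rewrite Rintegral_cst// mul0r mulr0.
apply/is_derive_onP => e e0; exists 1 => // s _ _ _.
by rewrite subrr mul0r subrr normr0.
Qed.

End CaputoAlgebra.

Section Potential.
Context {R : realType}.
Local Notation mu := (@lebesgue_measure R).

Lemma is_derive_on_primitive T (h : R -> R) t : continuous h -> 0 < t <= T ->
  is_derive_on T (fun s => \int[mu]_(r in `[0, s]) h r) t (h t).
Proof.
move=> hc /andP[t0 tT].
have tt1 : t < t + 1 by rewrite ltrDl.
have hi : mu.-integrable `[0, (t + 1)] (EFin \o h).
  apply: continuous_compact_integrable; first exact: segment_compact.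
  exact: continuous_subspaceT.
have [dF Fh] := @continuous_FTC1_closed R h 0 t (t + 1) tt1 hi t0 (hc t).
move: dF Fh; set F := (fun s => _) => dF Fh.
rewrite derive1E in Fh.
have : (fun k => k^-1 *: ((F \o shift t) (k *: 1) - F t)) @ 0^' --> h t.
  by rewrite -Fh; exact: dF.
move=> /cvgrPdist_lt FhP; apply/is_derive_onP => e e0.
have := FhP e e0; rewrite near_withinE => /nbhs_ballP[d /= d0 dP].
exists d => // s sT st std.
have := dP (s - t); rewrite /ball/= sub0r normrN => /(_ std).
rewrite subr_eq0 => /(_ st); rewrite distrC.
by rewrite /GRing.scale/= mulr1 subrK mulrC.
Qed.

Lemma frac_int_eq0 a (u : R -> R) t : 0 < a -> t <= 0 -> frac_int a u t = 0.
Proof.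
move=> a0; rewrite /frac_int gt_eqF// le_eqVlt => /predU1P[->|t0].
  by rewrite set_itv1 Rintegral_set1 mulr0.
by rewrite set_itv_ge ?bnd_simp -?ltNge// Rintegral_set0 mulr0.
Qed.

(** The semigroup identity for [frac_int].  The constant c is positive, but it is
    left unevaluated: only its sign is used, which spares the evaluation of B(a, 1 - a). *)
Lemma frac_int_compl a : 0 < a <= 1 -> exists2 c : R, 0 < c &
  forall h : R -> R, continuous h -> (forall x, 0 <= h x) ->
  forall s, 0 <= s ->
    frac_int (1 - a) (fun r => frac_int a h r - frac_int a h 0) s =
    c * \int[mu]_(r in `[0, s]) h r.
Proof.
move=> /andP[a0 a1].
have Ga : 0 < euler_Gamma a :> R by exact: euler_Gamma_gt0.
have [a1E|a_neq1] := eqVneq a 1.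
  exists (euler_Gamma a)^-1; first by rewrite invr_gt0.
  move=> h hc h0 s s0; rewrite a1E subrr frac_int0 (@frac_int_eq0 1 h 0)// subr0.
  rewrite /frac_int oner_eq0; congr (_ * _).
  by apply: eq_Rintegral => r _; rewrite subrr powRr0 mul1r.
pose b := 1 - a.
have a_lt1 : a < 1 by rewrite lt_neqAle a_neq1.
have b01 : 0 < b < 1 by rewrite /b subr_gt0 a_lt1/=; lra.
have /andP[b0 b1] := b01.
have bE : 1 - b = a by rewrite /b; ring.
have Gb : 0 < euler_Gamma b :> R by apply: euler_Gamma_gt0 => //; exact: ltW.
have k0 : 0 < beta_const b :> R by exact: beta_const_gt0.
exists ((euler_Gamma b)^-1 * (euler_Gamma a)^-1 * beta_const b).
  by rewrite mulr_gt0 // mulr_gt0 ?invr_gt0.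
move=> h hc h0 s s0.
have [M M0 hM] := @within_continuous_bounded R 0 s h (continuous_subspaceT hc).
pose w := h \_ `[0, s].
have mw : measurable_fun setT w.
  by apply: measurable_patchT => //; exact: continuous_measurable_fun.
have wM r : 0 <= w r <= M.
  rewrite /w patchE mem_setE in_itv/=; case: ifPn => [rs|_]; last by rewrite lexx.
  by rewrite h0 (le_trans (ler_norm _))// hM.
have w0 r : r < 0 -> w r = 0.
  by move=> r0; rewrite /w patchE mem_setE in_itv/= leNgt r0.
have w_ge0 r : 0 <= w r by case/andP : (wM r).
have mconv : measurable_fun setT (fun r : R => (rl_conv a w r)%:E).
  rewrite (_ : (fun r : R => (rl_conv a w r)%:E) =
      (fun r => \int[mu]_q (rl_kernel a (r - q) * w q)%:E)%E).
    exact: measurable_rl_convE.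
  by apply/funext => r; rewrite (rl_convE _ a0 mw wM w0).
have e1 : rl_conv b (fun r => rl_conv a w r) s = beta_const b * \int[mu]_(r in `[0, s]) h r.
  have cv := rl_kernel_convol s b01 mw w_ge0.
  transitivity (fine (\int[mu]_r ((rl_kernel b (s - r))%:E *
      \int[mu]_q (rl_kernel (1 - b) (r - q) * w q)%:E))%E).
    rewrite /rl_conv {1}/Rintegral; congr fine; apply: eq_integral => r _.
    by rewrite bE (rl_convE _ a0 mw wM w0).
  rewrite cv.
  have -> : (\int[mu]_(r in `]-oo, s[) (w r)%:E = \int[mu]_(r in `[0%R, s]) (h r)%:E)%E.
    rewrite [RHS]integral_mkcond integral_itv_bndo_bndc; last first.
      by apply/measurable_EFinP/measurable_funTS.
    rewrite [LHS]integral_mkcond; apply: eq_integral => r _.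
    rewrite !patchE !mem_setE !in_itv/= /w patchE mem_setE in_itv/=.
    by have [rs|rs] := leP r s; rewrite ?andbF ?andbT//; case: ifP.
  have hi : mu.-integrable `[0, s] (EFin \o h).
    apply: continuous_compact_integrable; first exact: segment_compact.
    exact: continuous_subspaceT.
  by rewrite fineM//; exact: integrable_fin_num.
rewrite -(mulrA _ _ (beta_const b)) -mulrA -mulrA -e1.
rewrite (frac_int_rl_conv _ b0 (lexx s)); congr (_ * _).
rewrite /rl_conv -RintegralZl//.
- rewrite /Rintegral; congr fine; apply: eq_integral => r _; congr EFin.
  rewrite mulrCA patchE mem_setE in_itv/=.
  have [rs|rs] := leP r s; last first.
    by rewrite andbF rl_kernel_lt0 ?subr_lt0// !mul0r.
  rewrite andbT; congr (_ * _).
  rewrite (@frac_int_eq0 a h 0)// subr0 (frac_int_rl_conv _ a0 rs) -/w.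
  have [//|r0] := leP 0 r; rewrite /rl_conv /Rintegral.
  by rewrite (rl_conv_before a w0 r0) mulr0.
- apply/integrableP; split.
    apply/measurable_EFinP; apply: measurable_funM.
      exact: measurable_rl_kernelB.
    exact/measurable_EFinP.
  have kw0 r : 0 <= rl_kernel b (s - r) * rl_conv a w r.
    by rewrite mulr_ge0 ?rl_kernel_ge0 ?rl_conv_ge0.
  under eq_integral => r _ do rewrite /= ger0_norm//.
  have cv := rl_kernel_convol s b01 mw w_ge0.
  have -> : (\int[mu]_r (rl_kernel b (s - r) * rl_conv a w r)%:E)%E =
      (\int[mu]_r ((rl_kernel b (s - r))%:E *
      \int[mu]_q (rl_kernel (1 - b) (r - q) * w q)%:E))%E.
    by apply: eq_integral => r _; rewrite bE (rl_convE _ a0 mw wM w0).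
  rewrite cv.
  apply: lte_mul_pinfty; rewrite ?lee_fin ?ltW//.
  apply: (@le_lt_trans _ _ (\int[mu]_(r in `]-oo, s]) (w r)%:E)%E).
    apply: ge0_subset_integral => //.
    - by apply/measurable_EFinP/measurable_funTS.
    - by move=> r _; rewrite lee_fin.
    - by move=> r /=; rewrite !in_itv/=; exact: ltW.
  apply: (@le_lt_trans _ _ (\int[mu]_(r in `[0%R, s]) M%:E)%E); last first.
    by rewrite integral_cst//= lebesgue_measure_itv/=; case: ifP => _;
      rewrite -?EFinD -?EFinM ?mule0 ltry.
  rewrite integral_mkcond [leRHS]integral_mkcond; apply: ge0_le_integral => //.
  - by move=> r _; rewrite patchE; case: ifP => // _; rewrite lee_fin.
  - apply: (iffLR (measurable_restrictT _ _)) => //.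
    by apply/measurable_EFinP/measurable_funTS.
  - by apply: (iffLR (measurable_restrictT _ _)).
  - move=> r _; rewrite !patchE !mem_setE !in_itv/=.
    have [r0|r0] := ltP r 0; first by rewrite w0//= if_same.
    case: ifP => rs /=; rewrite ?rs// lee_fin.
    by case/andP : (wM r).
Qed.

Lemma is_caputo_frac_int a : 0 < a <= 1 -> exists2 c : R, 0 < c &
  forall (h : R -> R) T t, continuous h -> (forall x, 0 <= h x) -> 0 < t <= T ->
    is_caputo T a (frac_int a h) t (c * h t).
Proof.
move=> a01; have [c c0 cP] := frac_int_compl a01.
exists c => // h T t hc h0 tT.
have tT' : 0 <= t <= T by case/andP : tT => t0 ->; rewrite ltW.
apply: (@is_derive_on_eq _ T (fun s => 0 + c * \int[mu]_(r in `[0, s]) h r)) => //.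
  by move=> s /andP[s0 _]; rewrite add0r cP.
rewrite -[c * h t]add0r; apply: is_derive_on_lin.
  apply/is_derive_onP => e e0; exists 1 => // s _ _ _.
  by rewrite subrr mul0r subrr normr0.
exact: is_derive_on_primitive.
Qed.

End Potential.

(** * Continuity and growth of fractional integrals *)

Section PotentialBounds.
Context {R : realType}.
Local Notation mu := (@lebesgue_measure R).

Lemma frac_int_le a (u v : R -> R) t : 0 < a <= 1 -> 0 <= t ->
  {within `[0, t], continuous u} -> {within `[0, t], continuous v} ->
  (forall s, 0 <= s <= t -> u s <= v s) -> frac_int a u t <= frac_int a v t.
Proof.
move=> /andP[a0 a1] t0 uc vc uv; rewrite /frac_int gt_eqF//.
rewrite ler_wpM2l// ?invr_ge0 ?(ltW (euler_Gamma_gt0 a0 a1))//.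
apply: le_Rintegral => //; [exact: frac_int_integrable..|].
by move=> s /=; rewrite in_itv/= => st; rewrite ler_wpM2l ?powR_ge0// uv.
Qed.

Lemma frac_int_ge0 a (u : R -> R) t : 0 < a <= 1 ->
  (forall s, 0 <= s <= t -> 0 <= u s) -> 0 <= frac_int a u t.
Proof.
move=> /andP[a0 a1] u0; rewrite /frac_int gt_eqF//.
rewrite mulr_ge0 ?invr_ge0 ?(ltW (euler_Gamma_gt0 a0 a1))//.
apply: Rintegral_ge0 => s /=; rewrite in_itv/= => st.
by rewrite mulr_ge0 ?powR_ge0// u0.
Qed.

Lemma frac_int_cst1_gt0 (a t : R) : 0 < a <= 1 -> 0 < t -> 0 < frac_int a (fun=> 1) t.
Proof.
move=> /andP[a0 a1] t0; rewrite frac_int_cst1 ?ltW//.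
by rewrite mulr_gt0 ?invr_gt0 ?euler_Gamma_gt0// divr_gt0// powR_gt0.
Qed.

(** In this form t appears in the integrand only as an argument of h, so that
    continuity in t passes under the integral sign. *)
Lemma frac_int_scale a (h : R -> R) t : 0 < a -> continuous h -> (forall x, 0 <= h x) ->
  0 <= t -> frac_int a h t = (euler_Gamma a)^-1 *
    (t `^ a * \int[mu]_(s in `[0, 1]) (rl_kernel a s * h (t * (1 - s)))).
Proof.
move=> a0 hc h0; rewrite le_eqVlt => /predU1P[<-|t0].
  by rewrite frac_int_eq0// powR0 ?gt_eqF// mul0r mulr0.
rewrite (frac_int_rl_conv _ a0 (lexx t)); congr (_ * _).
pose w := h \_ `[0, t].
have mh : measurable_fun setT h by exact: continuous_measurable_fun.
have mw : measurable_fun setT w by exact: measurable_patchT.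
have w0 s : 0 <= w s by rewrite /w patchE; case: ifP.
rewrite /rl_conv -/w /Rintegral.
have mht : measurable_fun setT (fun s : R => h (t * (1 - s))).
  apply: (measurableT_comp mh); apply: measurable_funM => //.
  exact: measurable_funB.
rewrite -[t `^ a]/(fine (t `^ a)%:E) -fineM//; last first.
  have [M M0 hM] := @within_continuous_bounded R 0 t h (continuous_subspaceT hc).
  rewrite ge0_fin_numE; last first.
    by apply: integral_ge0 => s _; rewrite lee_fin mulr_ge0 ?rl_kernel_ge0.
  apply: (@le_lt_trans _ _ (\int[mu]_(s in `[0%R, 1%R]) (M%:E * (rl_kernel a s)%:E))%E).
    apply: ge0_le_integral => //.
    - by move=> s _; rewrite lee_fin mulr_ge0 ?rl_kernel_ge0.
    - apply/measurable_EFinP/measurable_funTS; apply: measurable_funM => //.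
      exact: measurable_rl_kernel.
    - apply/measurable_EFinP/measurable_funTS; apply: measurable_funM => //.
      exact: measurable_rl_kernel.
    - move=> s /=; rewrite in_itv/= => /andP[s0 s1].
      rewrite lee_fin mulrC ler_wpM2r ?rl_kernel_ge0//.
      rewrite (le_trans (ler_norm _))// hM// mulr_ge0 ?subr_ge0 ?(ltW t0)//=.
      by rewrite ler_piMr ?(ltW t0)// lerBlDr lerDl.
  rewrite ge0_integralZl//.
  - by rewrite integral_rl_kernel// -EFinM ltry.
  - by apply/measurable_EFinP/measurable_funTS; exact: measurable_rl_kernel.
  - by move=> s _; rewrite lee_fin rl_kernel_ge0.
congr fine.
rewrite (@ge0_integral_reflect _ t); last 2 first.
- apply/measurable_EFinP; apply: measurable_funM => //.
  exact: measurable_rl_kernelB.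
- by move=> s; rewrite lee_fin mulr_ge0 ?rl_kernel_ge0.
rewrite (@ge0_integral_affine _ t 0)//; last 2 first.
- apply/measurable_EFinP; apply: measurable_funM => //.
    apply: (measurableT_comp (measurable_rl_kernel a)).
    by apply: measurable_funB => //; exact: measurable_funB.
  apply: (measurableT_comp mw); exact: measurable_funB.
- by move=> s; rewrite lee_fin mulr_ge0 ?rl_kernel_ge0.
have tE : t `^ a = t * t `^ (a - 1) by rewrite mulr_powRB1// ltW.
rewrite tE EFinM -muleA; congr (_ * _)%E.
rewrite -ge0_integralZl//; last 3 first.
- apply/measurable_EFinP/measurable_funTS; apply: measurable_funM => //.
  exact: measurable_rl_kernel.
- by move=> s _; rewrite lee_fin mulr_ge0 ?rl_kernel_ge0.
- by rewrite lee_fin powR_ge0.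
rewrite [RHS]integral_mkcond; apply: eq_integral => s _.
rewrite patchE mem_setE in_itv/= addr0 subKr rl_kernelM// /w patchE mem_setE in_itv/=.
rewrite subr_ge0 lerBlDr lerDl pmulr_rge0// -[leRHS]mulr1 ler_pM2l//.
have -> : t - t * s = t * (1 - s) by ring.
by rewrite andbC; case: ifP => _; rewrite -?EFinM ?mulr0// mulrA.
Qed.

Lemma continuous_powR_pos (a : R) : 0 < a -> continuous (fun t : R => (Num.max 0 t) `^ a).
Proof.
move=> a0 t; apply/cvgrPdist_lt => e e0; apply/nbhs_ballP.
have [t0|t0|<-] := ltgtP 0 t.
- have /cvgrPdist_lt/(_ e e0)/nbhs_ballP[d /= d0 dP] := @continuous_powR R a t t0.
  exists (Num.min d t); first by rewrite /= lt_min d0.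
  move=> y; rewrite /ball/= lt_min => /andP[yd yt].
  have y0 : 0 < y by move: yt; rewrite ltr_norml => /andP[? ?]; lra.
  by rewrite !max_r ?ltW//; exact: dP.
- exists (- t); first by rewrite /= oppr_gt0.
  move=> y; rewrite /ball/= => yt.
  have y0 : y < 0 by move: yt; rewrite ltr_norml => /andP[? ?]; lra.
  by rewrite !max_l ?ltW// subrr normr0.
- exists (e `^ a^-1); first by rewrite /= powR_gt0.
  move=> y; rewrite /ball/= sub0r normrN => ye.
  rewrite powR0 ?gt_eqF// sub0r normrN ger0_norm ?powR_ge0//.
  have -> : e = (e `^ a^-1) `^ a by rewrite -powRrM mulVf ?gt_eqF// powRr1 ?ltW.
  apply: gt0_ltr_powR => //; rewrite ?nnegrE ?powR_ge0 ?le_max ?lexx//.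
  by rewrite gt_max powR_gt0//= (le_lt_trans (ler_norm _)).
Qed.

Lemma continuous_frac_int a (h : R -> R) : 0 < a -> continuous h -> (forall x, 0 <= h x) ->
  continuous (frac_int a h).
Proof.
move=> a0 hc h0.
pose f (t s : R) := rl_kernel a s * h (Num.max 0 t * (1 - s)).
have -> : frac_int a h = (fun t => (euler_Gamma a)^-1 *
    ((Num.max 0 t) `^ a * \int[mu]_(s in `[0, 1]) f t s)).
  apply/funext => t; have [t0|t0] := leP 0 t.
    by rewrite (frac_int_scale _ hc h0 t0)// /f max_r.
  by rewrite frac_int_eq0 ?ltW// powR0 ?gt_eqF// mul0r mulr0.
have cmax : continuous (fun t : R => Num.max 0 t).
  by move=> t; apply: (@continuous_max _ _ (fun=> 0) id t); [exact: cvg_cst|exact: cvg_id].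
have mh : measurable_fun setT h by exact: continuous_measurable_fun.
move=> t; apply: cvgM; first exact: cvg_cst.
apply: cvgM; first exact: continuous_powR_pos.
have mf x : measurable_fun setT (f x).
  apply: measurable_funM; first exact: measurable_rl_kernel.
  apply: (measurableT_comp mh); apply: measurable_funM => //.
  exact: measurable_funB.
pose N := `|t| + 1.
have N0 : 0 <= N by rewrite addr_ge0.
have [M M0 hM] := @within_continuous_bounded R 0 N h (continuous_subspaceT hc).
have ki : mu.-integrable `[0, 1] (EFin \o (fun s => M * rl_kernel a s)).
  apply: (@integrableZl _ _ _ mu _ (measurable_itv `[0, 1]) M (EFin \o rl_kernel a)).
  apply/integrableP; split.
    by apply/measurable_EFinP/measurable_funTS; exact: measurable_rl_kernel.
  under eq_integral => s _ do rewrite /= ger0_norm ?rl_kernel_ge0//.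
  by rewrite integral_rl_kernel// ltry.
have fM x s : x \in `]- N, N[%R -> s \in `[0, 1]%R -> `|f x s| <= M * rl_kernel a s.
  rewrite !in_itv/= => /andP[xN1 xN2] /andP[s0 s1].
  rewrite /f ger0_norm ?mulr_ge0 ?rl_kernel_ge0// mulrC ler_wpM2r ?rl_kernel_ge0//.
  rewrite (le_trans (ler_norm _))// hM//.
  have m0 : 0 <= Num.max 0 x by rewrite le_max lexx.
  have mN : Num.max 0 x <= N by rewrite ge_max N0 ltW.
  rewrite mulr_ge0 ?subr_ge0//= (le_trans _ mN)//.
  by rewrite ler_piMr// lerBlDr lerDl.
apply: (@continuity_under_integral R _ _ mu f `[0, 1] _ (- N) N _ _
  (fun s => M * rl_kernel a s)) => //.
- move=> x xN; apply: (le_integrable _ _ _ ki) => //.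
    by apply/measurable_EFinP; apply: measurable_funTS; exact: mf.
  move=> s s01; rewrite /= lee_fin [leRHS]ger0_norm ?mulr_ge0 ?rl_kernel_ge0//.
  exact: fM.
- apply/aeW => s _ x _; apply: cvgM; first exact: cvg_cst.
  apply: (@cvg_comp _ _ _ (fun x => Num.max 0 x * (1 - s)) h _
    (nbhs (Num.max 0 x * (1 - s)))); last exact: hc.
  by apply: cvgM; [exact: cmax|exact: cvg_cst].
- by move=> x xN; apply/aeW => s s01; exact: fM.
- rewrite inE/= in_itv/=; have := ler_norm t; have := ler_norm (- t).
  by rewrite normrN /N => *; apply/andP; split; lra.
Qed.

(** Constant equal to 1 until dl, exponential with rate lam afterwards: dl controls
    its fractional integrals at early times, and lam at late times. *)
Definition delayed_exp (lam dl t : R) : R := expR (lam * Num.max 0 (t - dl)).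

Lemma delayed_exp_ge1 lam dl t : 0 <= lam -> 1 <= delayed_exp lam dl t.
Proof.
by move=> l0; rewrite -expR0 ler_expR mulr_ge0// le_max lexx.
Qed.

Lemma delayed_exp1 lam dl t : t <= dl -> delayed_exp lam dl t = 1.
Proof.
by move=> tdl; rewrite /delayed_exp max_l ?subr_le0// mulr0 expR0.
Qed.

Lemma delayed_exp_homo lam dl s t : 0 <= lam -> s <= t ->
  delayed_exp lam dl s <= delayed_exp lam dl t.
Proof.
move=> l0 st; rewrite ler_expR ler_wpM2l// ge_max !le_max lexx/=.
by rewrite lerB ?orbT.
Qed.

Lemma continuous_delayed_exp lam dl : continuous (delayed_exp lam dl).
Proof.
move=> t; apply: (@continuous_comp _ _ _ (fun t => lam * Num.max 0 (t - dl)) expR).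
  apply: cvgM; first exact: cvg_cst.
  apply: (@continuous_max _ _ (fun=> 0) (fun t => t - dl) t); first exact: cvg_cst.
  by apply: cvgB; [exact: cvg_id|exact: cvg_cst].
exact: continuous_expR.
Qed.

Lemma delayed_exp_lag lam dl s t : 0 <= lam -> 0 < dl -> 0 <= s -> s <= t - dl *+ 2 ->
  delayed_exp lam dl s <= expR (- (lam * dl)) * delayed_exp lam dl t.
Proof.
move=> l0 dl0 s0 st; rewrite /delayed_exp -expRD ler_expR -mulrN -mulrDr.
rewrite ler_wpM2l// ge_max; rewrite mulr2n in st.
have -> : Num.max 0 (t - dl) = t - dl by rewrite max_r//; lra.
by apply/andP; split; lra.
Qed.

(** In the integral at time t, a time lag of at most 2 dl contributes at most e(t)
    times the integral of the kernel over [0, 2 dl], while a longer lag costs a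
    factor exp (- lam dl) ([delayed_exp_lag]). *)
Lemma frac_int_delayed_exp a lam dl t T : 0 < a <= 1 -> 0 <= lam -> 0 < dl ->
  0 <= t <= T ->
  frac_int a (delayed_exp lam dl) t <= delayed_exp lam dl t *
    (frac_int a (fun=> 1) (dl *+ 2) + expR (- (lam * dl)) * frac_int a (fun=> 1) T).
Proof.
move=> /andP[a0 a1] l0 dl0 /andP[t0 tT]; set e := delayed_exp lam dl.
have T0 := le_trans t0 tT.
have d20 : 0 <= dl *+ 2 by rewrite mulrn_wge0// ltW.
have G0 := euler_Gamma_gt0 a0 a1.
rewrite !frac_int_cst1// (frac_int_rl_conv _ a0 (lexx t)).
rewrite [X in e t * X](_ : _ = (euler_Gamma a)^-1 * ((dl *+ 2) `^ a / a +
  expR (- (lam * dl)) * (T `^ a / a))); last by ring.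
rewrite mulrCA ler_pM2l ?invr_gt0//.
pose w := e \_ `[0, t].
have ce : continuous e by exact: continuous_delayed_exp.
have e0 s : 0 <= e s by exact: expR_ge0.
have me : measurable_fun setT e by exact: continuous_measurable_fun.
have mw : measurable_fun setT w by exact: measurable_patchT.
have wM s : 0 <= w s <= e t.
  rewrite /w patchE mem_setE in_itv/=; case: ifPn => [/andP[s0 st]|_].
    by rewrite e0 delayed_exp_homo.
  by rewrite lexx e0.
have w0 s : s < 0 -> w s = 0.
  by move=> s0; rewrite /w patchE mem_setE in_itv/= leNgt s0.
rewrite -/w -lee_fin -(rl_convE t a0 mw wM w0).
(* q and p bound the contributions of short and of arbitrary time lags *)
pose q := rl_kernel a \_ `[0, dl *+ 2]; pose p := rl_kernel a \_ `[0, T].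
have mq : measurable_fun setT q.
  by apply: measurable_patchT => //; exact: measurable_rl_kernel.
have mp : measurable_fun setT p.
  by apply: measurable_patchT => //; exact: measurable_rl_kernel.
have q0 s : 0 <= q s by rewrite /q patchE; case: ifP => // _; exact: rl_kernel_ge0.
have p0 s : 0 <= p s by rewrite /p patchE; case: ifP => // _; exact: rl_kernel_ge0.
have mqt : measurable_fun setT (fun s : R => (q (t - s))%:E).
  by apply/measurable_EFinP; apply: (measurableT_comp mq); exact: measurable_funB.
have mpt : measurable_fun setT (fun s : R => (p (t - s))%:E).
  by apply/measurable_EFinP; apply: (measurableT_comp mp); exact: measurable_funB.
have x0 : 0 <= expR (- (lam * dl)) by exact: expR_ge0.
have mxpt : measurable_fun setT (fun s : R => (expR (- (lam * dl)))%:E * (p (t - s))%:E)%E.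
  exact: emeasurable_funM.
apply: (@le_trans _ _ (\int[mu]_s ((e t)%:E * ((q (t - s))%:E +
    (expR (- (lam * dl)))%:E * (p (t - s))%:E)))%E).
  apply: ge0_le_integral => //.
  - move=> s _; rewrite lee_fin mulr_ge0 ?rl_kernel_ge0//; by case/andP : (wM s).
  - by apply/measurable_EFinP; apply: measurable_funM => //; exact: measurable_rl_kernelB.
  - by apply: emeasurable_funM => //; exact: emeasurable_funD.
  move=> s _; rewrite lee_fin.
  have [s0|s0] := ltP s 0.
    by rewrite w0// mulr0 mulr_ge0// addr_ge0// mulr_ge0.
  have [st|st] := ltP t s.
    by rewrite rl_kernel_lt0 ?subr_lt0// mul0r mulr_ge0// addr_ge0// mulr_ge0.
  have -> : w s = e s by rewrite /w patchE mem_setE in_itv/= s0 st.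
  have -> : p (t - s) = rl_kernel a (t - s).
    by rewrite /p patchE mem_setE in_itv/= subr_ge0 st lerBlDr (le_trans tT)// lerDl.
  rewrite /q patchE mem_setE in_itv/= subr_ge0 st/=.
  case: ifPn => [ts|]; last rewrite -ltNge => ts.
    rewrite mulrC mulrDr -[leLHS]addr0 lerD//.
      by rewrite ler_wpM2r ?rl_kernel_ge0// delayed_exp_homo.
    by rewrite !mulr_ge0// rl_kernel_ge0.
  rewrite add0r mulrA mulrC ler_wpM2r ?rl_kernel_ge0// mulrC.
  by apply: delayed_exp_lag => //; rewrite lerBrDl -lerBrDr ltW.
rewrite ge0_integralZl//; last 3 first.
- exact: emeasurable_funD.
- by move=> s _; rewrite -EFinM -EFinD lee_fin addr_ge0// mulr_ge0.
- by rewrite lee_fin.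
rewrite EFinM lee_wpmul2l ?lee_fin//.
rewrite ge0_integralD//; last 2 first.
- by move=> s _; rewrite lee_fin.
- by move=> s _; rewrite -EFinM lee_fin mulr_ge0.
rewrite ge0_integralZl//; last first.
  by move=> s _; rewrite lee_fin.
rewrite -(@ge0_integral_reflect _ t (fun s => (q s)%:E)); last 2 first.
- exact/measurable_EFinP.
- by move=> s; rewrite lee_fin.
rewrite -(@ge0_integral_reflect _ t (fun s => (p s)%:E)); last 2 first.
- exact/measurable_EFinP.
- by move=> s; rewrite lee_fin.
by rewrite !integral_rl_kernel_patch// -EFinM -EFinD.
Qed.

End PotentialBounds.

(** * Comparison functions *)

Section Growth.
Context {R : realType}.

(** U i and V i are the fractional integrals of 1 and of the delayed exponential e,
    normalised so as to have these functions as Caputo derivatives.  Taking first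
    dl small and then lam large makes them as small as desired compared with e. *)
Lemma comparison_functions (d : nat) (alpha : 'I_d -> R) (T eps D0 B0 : R) :
  (forall i, 0 < alpha i <= 1) -> 0 < eps -> 0 < D0 ->
  exists dl lam : R, exists U V : 'I_d -> R -> R,
    [/\ 0 < dl <= D0, 0 <= lam, B0 <= expR (lam * dl) & forall i,
     [/\ continuous (U i) /\ continuous (V i),
         forall t, t <= 0 -> U i t = 0 /\ V i t = 0,
         forall t, 0 < t <= T -> is_caputo T (alpha i) (U i) t 1 /\
           is_caputo T (alpha i) (V i) t (delayed_exp lam dl t),
         forall t, 0 < t <= dl -> 0 < U i t /\ V i t = U i t &
         forall t, 0 <= t <= T ->
           [/\ 0 <= U i t, U i t <= V i t & V i t <= eps * delayed_exp lam dl t]]].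
Proof.
move=> a01 eps0 D00.
have a0 i : 0 < alpha i by case/andP : (a01 i).
have cex i : exists c : R, 0 < c /\
  forall (h : R -> R) T t, continuous h -> (forall x, 0 <= h x) -> 0 < t <= T ->
    is_caputo T (alpha i) (frac_int (alpha i) h) t (c * h t).
  by have [c c0 cP] := is_caputo_frac_int (a01 i); exists c.
have {cex}[c cP] := choice cex.
have c0 i : 0 < c i by case: (cP i).
have c1 : continuous (fun _ : R => 1 : R) by move=> t; exact: cvg_cst.
pose J i h t := (c i)^-1 * frac_int (alpha i) h t.
have Jc i (h : R -> R) : continuous h -> (forall x, 0 <= h x) -> continuous (J i h).
  move=> hc h0 t; apply: cvgM; first exact: cvg_cst.
  exact: (continuous_frac_int (a0 i) hc h0).
have J0 i (h : R -> R) (t : R) : t <= 0 -> J i h t = 0.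
  by move=> t0; rewrite /J frac_int_eq0 ?mulr0.
have Jcap i (h : R -> R) (t : R) : continuous h -> (forall x, 0 <= h x) -> 0 < t <= T ->
    is_caputo T (alpha i) (J i h) t (h t).
  move=> hc h0 tT; have tT' : 0 <= t <= T by case/andP : tT => t0 ->; rewrite ltW.
  have := @is_caputo_lin _ T (alpha i) (fun=> 0) (frac_int (alpha i) h) (c i)^-1 t 0
    (c i * h t) _ tT' _ _ (is_caputo_cst _ _ tT') ((cP i).2 h T t hc h0 tT).
  rewrite mulrA mulVf ?gt_eqF// mul1r add0r => jc.
  have -> : J i h = (fun s => 0 + (c i)^-1 * frac_int (alpha i) h s).
    by apply/funext => s; rewrite add0r.
  apply: jc.
  - by case/andP : (a01 i).
  - by move=> s; exact: cvg_cst.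
  - exact/continuous_subspaceT/(continuous_frac_int (a0 i) hc h0).
have ci0 i : 0 < (c i)^-1 by rewrite invr_gt0.
pose U i := J i (fun=> 1).
have Uc i : continuous (U i) by apply: Jc.
have U_ge0 i t : 0 <= U i t.
  by rewrite mulr_ge0 ?(ltW (ci0 i))// frac_int_ge0.
have eps2 : 0 < eps / 2 by rewrite divr_gt0.
have : \forall x \near (0 : R), forall i, `|U i x| < eps / 2.
  apply: (@filter_forall R _ (fun i x => `|U i x| < eps / 2) (nbhs (0 : R))) => i.
  have /cvgrPdist_lt/(_ _ eps2) := Uc i 0.
  rewrite /U J0//; apply: filterS => x.
  by rewrite sub0r normrN.
move=> /nbhs_ballP[d1 /= d10 d1P].
pose dl := Num.min D0 (d1 / 4).
have dl0 : 0 < dl by rewrite lt_min D00 divr_gt0.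
have dld1 : dl <= d1 / 4 by rewrite ge_min lexx orbT.
have U2 i : U i (dl *+ 2) < eps / 2.
  rewrite (le_lt_trans (ler_norm _))//; apply: d1P.
  rewrite /ball/= sub0r normrN ger0_norm ?mulrn_wge0 ?(ltW dl0)//.
  by rewrite mulr2n; lra.
pose S := \sum_i U i T.
have US i : U i T <= S by rewrite /S (bigD1 i)//= lerDl sumr_ge0.
have S0 : 0 <= S by rewrite sumr_ge0.
(* the target value of lam * dl: exp K >= 1 + K then gives both bounds on exp K *)
pose K := `|B0| + 2 * S / eps.
have SE : 0 <= 2 * S / eps by rewrite divr_ge0 ?mulr_ge0// ltW.
have K0 : 0 <= K by rewrite addr_ge0.
pose lam := K / dl.
have lam0 : 0 <= lam by rewrite divr_ge0// ltW.
have lamK : lam * dl = K by rewrite /lam divfK// gt_eqF.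
have eK : 1 + K <= expR K by exact: expR_ge1Dx.
pose e := delayed_exp lam dl.
have ec : continuous e by exact: continuous_delayed_exp.
have e0 t : 0 <= e t by exact: expR_ge0.
have e1 t : 1 <= e t by exact: delayed_exp_ge1.
exists dl, lam, U, (fun i => J i e); split=> //.
- by rewrite dl0 ge_min lexx.
- rewrite lamK (le_trans _ eK)//; have := ler_norm B0; rewrite /K; lra.
move=> i; split.
- by split; [exact: Uc|exact: Jc].
- by move=> t t0; rewrite /U !J0.
- by move=> t tT; split; exact: Jcap.
- move=> t /andP[t0 tdl]; split.
    by rewrite mulr_gt0// frac_int_cst1_gt0.
  congr (_ * _); apply: frac_int_eq; first exact: ltW.
  by move=> s /andP[_ st]; rewrite /e delayed_exp1// (le_trans st).
move=> t /andP[t0 tT]; split; first exact: U_ge0.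
- rewrite ler_wpM2l ?(ltW (ci0 i))// frac_int_le//.
  + exact: continuous_subspaceT.
  + exact: continuous_subspaceT.
have tT' : 0 <= t <= T by rewrite t0.
have := frac_int_delayed_exp (a01 i) lam0 dl0 tT'.
rewrite -(ler_pM2l (ci0 i)) => /le_trans; apply.
rewrite mulrCA (mulrC eps) ler_wpM2l// mulrDr mulrCA.
change (U i (dl *+ 2) + expR (- (lam * dl)) * U i T <= eps).
suff : expR (- (lam * dl)) * U i T <= eps / 2.
  move: (U2 i); generalize (U i (dl *+ 2)) (expR (- (lam * dl)) * U i T).
  by clear; move=> ? ?; lra.
rewrite expRN mulrC ler_pdivrMr ?expR_gt0// lamK.
rewrite (le_trans (US i))// (@le_trans _ _ (eps / 2 * (1 + K)))//; last first.
  by rewrite ler_wpM2l// ltW.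
rewrite /K -[leLHS](_ : eps / 2 * (2 * S / eps) = S); last by field; rewrite gt_eqF.
rewrite ler_wpM2l ?(ltW eps2)//.
by have := normr_ge0 B0; lra.
Qed.

End Growth.

(** * First zeros and vector-valued functions *)

Section FirstZero.
Context {R : realType}.

(** The infimum of the times at which some component is nonpositive is attained, by
    finiteness of I and continuity; all components are nonnegative up to that time. *)
Lemma first_zero (I : finType) (T : R) (z : I -> R -> R) : 
  (forall i, {within `[0, T], continuous (z i)}) ->
  (forall i, 0 < z i 0) ->
  (forall t, 0 < t <= T -> (forall i s, 0 <= s <= t -> 0 <= z i s) ->
     forall i, z i t != 0) ->
  forall i t, 0 <= t <= T -> 0 < z i t.
Proof.
move=> zc z0 zP i t tT; rewrite ltNge; apply/negP => zt.
pose S := [set s | 0 <= s <= T /\ exists j, z j s <= 0].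
have St : S t by split=> //; exists i.
have Slb : lbound S 0 by move=> s [/andP[]].
have hS : has_inf S by split; [exists t|exists 0].
pose m := inf S.
have m0 : 0 <= m by apply: lb_le_inf => //; exists t.
have mt : m <= t by apply: ge_inf => //; exists 0.
have mT : 0 <= m <= T by rewrite m0 (le_trans mt)//; case/andP : tT.
have before s j : 0 <= s < m -> 0 < z j s.
  move=> /andP[s0 sm]; rewrite ltNge; apply/negP => zs.
  have : m <= s; last by rewrite leNgt sm.
  apply: ge_inf; first by exists 0.
  by split; [rewrite s0 (le_trans (ltW sm))//; case/andP : mT|exists j].
have pos : ~ (forall j, 0 < z j m).
  move=> zm.
  have : \forall x \near m, forall j, 0 <= x <= T -> 0 < z j x.
    apply: (@filter_forall R _ (fun j x => 0 <= x <= T -> 0 < z j x) (nbhs m)) => j.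
    have [d d0 dP] := (within_continuousE 0 T (z j)).1 (zc j) m mT _ (zm j).
    apply/nbhs_ballP; exists d => //= x; rewrite /ball/= distrC => xm xT.
    have := dP x xT xm; rewrite ltr_norml => /andP[+ _]; have := zm j; lra.
  move=> /nbhs_ballP[d /= d0 dP].
  have [s [sT [j zs]] sm] := inf_adherent d0 hS.
  have ms : m <= s by apply: ge_inf; [exists 0|split=> //; exists j].
  have := dP s; rewrite /ball/= distrC ger0_norm ?subr_ge0// ltrBlDl.
  by move=> /(_ sm j sT); rewrite ltNge zs.
have m_gt0 : 0 < m.
  rewrite lt_neqAle m0 andbT; apply/eqP => m0E; apply: pos => j.
  by rewrite -m0E.
have zm_ge0 j : 0 <= z j m.
  rewrite leNgt; apply/negP => zm.
  have zmN : 0 < - z j m by rewrite oppr_gt0.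
  have [d d0 dP] := (within_continuousE 0 T (z j)).1 (zc j) m mT _ zmN.
  pose s := Num.max (m / 2) (m - d / 2).
  have s1 : m / 2 <= s by rewrite le_max lexx.
  have s2 : m - d / 2 <= s by rewrite le_max lexx orbT.
  have s3 : s < m by rewrite gt_max; apply/andP; split; lra.
  have zs : 0 < z j s by apply: before; rewrite s3 andbT; lra.
  have := dP s; rewrite ltr0_norm ?subr_lt0//.
  have -> : 0 <= s <= T by case/andP : mT => _ ?; apply/andP; split; lra.
  have -> : - (s - m) < d by lra.
  by move=> /(_ isT isT); rewrite ltr_norml => /andP[_ ?]; lra.
apply: pos => j; rewrite lt_neqAle zm_ge0 andbT eq_sym; apply: zP.
  by rewrite m_gt0; case/andP : mT.
move=> k s /andP[s0]; rewrite le_eqVlt => /predU1P[->//|sm].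
by apply: ltW; apply: before; rewrite s0.
Qed.

End FirstZero.

Section Vectors.
Context {R : realType}.

Lemma within_continuous_coord (m n : nat) (A : set R) (x : R -> 'M[R]_(m, n)) i j :
  {within A, continuous x} -> {within A, continuous (fun t => x t i j)}.
Proof.
move=> xc t.
apply: (@cvg_comp _ _ _ x (fun M : 'M[R]_(m, n) => M i j) _ (nbhs (x t))).
  exact: xc.
exact: coord_continuous.
Qed.

Lemma within_continuous_mx (m n : nat) (A : set R) (x : R -> 'M[R]_(m, n)) :
  (forall i j, {within A, continuous (fun t => x t i j)}) ->
  {within A, continuous x}.
Proof.
move=> xc t; apply/cvg_ballP => e e0.
have FF : Filter (nbhs (t : subspace A)) by exact: nbhs_filter.
have : \forall s \near (t : subspace A), forall i j, ball (x t i j) e (x s i j).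
  apply: (@filter_forall _ _ (fun i s => forall j, ball (x t i j) e (x s i j)) _ FF) => i.
  apply: (@filter_forall _ _ (fun j s => ball (x t i j) e (x s i j)) _ FF) => j.
  by have /cvg_ballP/(_ e e0) := xc i j t.
by apply: filterS => s xs; split.
Qed.

Lemma within_continuous_sum (I : finType) (A : set R) (F : I -> R -> R) :
  (forall i, {within A, continuous (F i)}) ->
  {within A, continuous (fun t => \sum_i F i t)}.
Proof.
move=> Fc; have -> : (fun t => \sum_i F i t) = \sum_i F i.
  by apply/funext => t; rewrite fct_sumE.
apply: (big_ind (fun g : R -> R => {within A, continuous g})) => //.
- by move=> t; exact: cvg_cst.
- by move=> f g fc gc t; apply: cvgD; [exact: fc|exact: gc].
Qed.

Lemma within_continuous_mulmx (m n : nat) (A : set R) (M : 'M[R]_(m, n))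
    (x : R -> 'cV[R]_n) i :
  (forall k, {within A, continuous (fun t => x t k 0)}) ->
  {within A, continuous (fun t => (M *m x t) i 0)}.
Proof.
move=> xc; have -> : (fun t => (M *m x t) i 0) = (fun t => \sum_k M i k * x t k 0).
  by apply/funext => t; rewrite mxE.
apply: within_continuous_sum => k t; apply: cvgM; first exact: cvg_cst.
exact: xc.
Qed.

Lemma within_continuous_delay (r T : R) (tau u : R -> R) :
  admissible_delay r T tau -> {within `[- r, T], continuous u} ->
  {within `[0, T], continuous (fun t => u (t - tau t))}.
Proof.
move=> [tc tP] uc; apply/within_continuousE => x xT e e0.
have dom y : 0 <= y <= T -> - r <= y - tau y <= T.
  move=> yT; have [|t0 ->] := tP y; first by rewrite in_itv.
  by case/andP : yT => ? ?; rewrite /=; lra.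
have [d d0 dP] := (within_continuousE _ _ u).1 uc _ (dom x xT) e e0.
have d2 : 0 < d / 2 by rewrite divr_gt0.
have [d' d'0 d'P] := (within_continuousE _ _ tau).1 tc x xT _ d2.
exists (Num.min (d / 2) d'); first by rewrite lt_min d2.
move=> y yT; rewrite lt_min => /andP[yd yd']; apply: dP; first exact: dom.
have -> : y - tau y - (x - tau x) = (y - x) - (tau y - tau x) by ring.
by rewrite (le_lt_trans (ler_normB _ _))//; have := d'P y yT yd'; lra.
Qed.

Lemma mulmx_bound (m n : nat) (M : 'M[R]_(m, n)) (v : 'cV[R]_n) b i :
  (forall k, `|v k 0| <= b) -> `|(M *m v) i 0| <= (\sum_k `|M i k|) * b.
Proof.
move=> vb; rewrite mxE (le_trans (ler_norm_sum _ _ _))// mulr_suml.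
by apply: ler_sum => k _; rewrite normrM ler_wpM2l.
Qed.

Lemma rowsum_bound (m n : nat) (M : 'M[R]_(m, n)) :
  exists2 K, 0 <= K & forall i, \sum_k `|M i k| <= K.
Proof.
exists (\sum_i \sum_k `|M i k|); first by rewrite !sumr_ge0// => i _; rewrite sumr_ge0.
by move=> i; rewrite [leRHS](bigD1 i)//= lerDl sumr_ge0// => j _; rewrite sumr_ge0.
Qed.

Lemma rowsum_bound_lt (m n : nat) (M : 'M[R]_(m, n)) c : 0 < c ->
  (forall i, \sum_k `|M i k| < c) ->
  exists2 rho, 0 <= rho < c & forall i, \sum_k `|M i k| <= rho.
Proof.
move=> c0 Mc; exists (\big[Num.max/0]_i \sum_k `|M i k|).
  apply/andP; split; first exact: bigmax_ge_id.
  by apply: bigmax_lt.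
by move=> i; exact: le_bigmax.
Qed.

End Vectors.

(** * Sign conditions imply positivity *)

Section Sufficiency.
Context {R : realType}.

Lemma nonneg_mulmx (m n : nat) (M : 'M[R]_(m, n)) (v : 'cV[R]_n) i :
  nonneg_mx M -> (forall k, 0 <= v k 0) -> 0 <= (M *m v) i 0.
Proof. by move=> M0 v0; rewrite mxE sumr_ge0// => k _; rewrite mulr_ge0. Qed.

Lemma metzler_mulmx (d : nat) (M : 'M[R]_d) (v : 'cV[R]_d) i :
  metzler M -> (forall k, 0 <= v k 0) -> v i 0 = 0 -> 0 <= (M *m v) i 0.
Proof.
move=> M0 v0 vi; rewrite mxE (bigD1 i)//= vi mulr0 add0r sumr_ge0// => k ki.
by rewrite mulr_ge0// M0// eq_sym.
Qed.

Lemma ge0_of_small_perturb (x w : R) : (forall eta, 0 < eta -> 0 < x + eta * w) -> 0 <= x.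
Proof.
move=> h; rewrite leNgt; apply/negP => x0.
have w0 : 0 < `|w| + 1 by rewrite ltr_wpDl.
have := h (- x / (`|w| + 1)).
rewrite divr_gt0 ?oppr_gt0// => /(_ isT).
have : - x / (`|w| + 1) * w <= - x.
  rewrite -mulrA ler_piMr ?oppr_ge0 ?(ltW x0)// mulrC ler_pdivrMr// mul1r.
  by rewrite (le_trans (ler_norm w))// lerDl.
lra.
Qed.

(** Comparison with the supersolution (1 + N V, L e).  The constants are chosen in
    the order L, N, lam: L makes the output part strict, N the state part, and lam
    enforces N V <= e, hence 1 + N V <= 2 e. *)
Lemma positive_system_of_sign_conditions (d n : nat) (r T : R) (alpha : 'I_d -> R)
    (A B : 'M[R]_d) (E : 'M[R]_(d, n)) (C : 'M[R]_(n, d)) (D : 'M[R]_n)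
    (tau1 tau2 tau3 : R -> R) :
  0 < r -> 0 < T -> (forall i, 0 < alpha i <= 1) ->
  (forall i, \sum_(j < n) `|D i j| < 1) ->
  metzler A -> nonneg_mx B -> nonneg_mx C -> nonneg_mx D -> nonneg_mx E ->
  admissible_delay r T tau1 -> admissible_delay r T tau2 ->
  admissible_delay r T tau3 ->
  positive_system r T alpha A B E C D tau1 tau2 tau3.
Proof.
move=> r0 T0 a01 rowD mA nB nC nD nE ad1 ad2 ad3 f g psi phi fc gc _ _ fg0 pp0 _ x y.
move=> [[xc yc] init caputo alg].
have [rho /andP[rho0 rho1] rhoP] := rowsum_bound_lt ltr01 rowD.
have [KA KA0 KAP] := rowsum_bound A; have [KB KB0 KBP] := rowsum_bound B.
have [KE KE0 KEP] := rowsum_bound E; have [KC KC0 KCP] := rowsum_bound C.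
have rho1' : 0 < 1 - rho by rewrite subr_gt0.
pose L := (2 * KC + 1) / (1 - rho).
have L0 : 0 < L by rewrite divr_gt0// ltr_wpDl// mulr_ge0.
have LE : L * (1 - rho) = 2 * KC + 1 by rewrite /L divfK// gt_eqF.
pose N := 2 * KA + 2 * KB + KE * L + 1.
have N0 : 0 < N by rewrite ltr_wpDl// !addr_ge0// mulr_ge0// ltW.
have NV0 : 0 < N^-1 by rewrite invr_gt0.
have [dl [lam [U [V [/andP[dl0 _] lam0 _ UV]]]]] :=
  @comparison_functions R d alpha T N^-1 1 1 a01 NV0 ltr01.
set e := delayed_exp lam dl in UV.
have ec : continuous e := @continuous_delayed_exp R lam dl.
have e1 t : 1 <= e t := delayed_exp_ge1 dl t lam0.
have e0 t : 0 < e t by exact: lt_le_trans (e1 t).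
have eM s t : s <= t -> e s <= e t by exact: delayed_exp_homo.
clearbody e.
have Vc i : continuous (V i) by case: (UV i) => -[].
have V0 i t : t <= 0 -> V i t = 0 by case: (UV i) => _ /(_ t) h _ _ _ /h[].
have V_ge0 i t : 0 <= t <= T -> 0 <= V i t.
  by move=> tT; case: (UV i) => _ _ _ _ /(_ t tT)[u0 uv _]; exact: le_trans uv.
have Ve i t : 0 <= t <= T -> N * V i t <= e t.
  move=> tT; case: (UV i) => _ _ _ _ /(_ t tT)[_ _ vt].
  by rewrite -ler_pdivlMl.
pose w i t := 1 + N * V i t.
have w_ge1 i t : t <= T -> 1 <= w i t.
  move=> tT; rewrite lerDl mulr_ge0 ?(ltW N0)//.
  have [t0|t0] := leP 0 t; first by rewrite V_ge0// t0.
  by rewrite V0// ltW.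
have w_le i s t : s <= t -> t <= T -> w i s <= 2 * e t.
  move=> st tT; have es := eM s t st; have et := e1 t; rewrite /w.
  have [s0|s0] := leP 0 s; last by rewrite V0 ?(ltW s0)// mulr0; lra.
  have := Ve i s; rewrite s0 (le_trans st tT) => /(_ isT); lra.
pose zx eta i t := x t i 0 + eta * w i t.
pose zy eta j t := y t j 0 + eta * (L * e t).
pose z eta (ij : 'I_d + 'I_n) :=
  match ij with inl i => zx eta i | inr j => zy eta j end.
have sub0 : `[0, T] `<=` `[- r, T].
  move=> s /=; rewrite !in_itv/= => /andP[s0 ->]; rewrite andbT; lra.
have xic i : {within `[- r, T], continuous (fun t => x t i 0)}.
  exact: within_continuous_coord.
have yjc j : {within `[- r, T], continuous (fun t => y t j 0)}.
  exact: within_continuous_coord.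
have xic0 i : {within `[0, T], continuous (fun t => x t i 0)}.
  exact: (continuous_subspaceW sub0 (xic i)).
have yjc0 j : {within `[0, T], continuous (fun t => y t j 0)}.
  exact: (continuous_subspaceW sub0 (yjc j)).
have wc i : continuous (w i).
  move=> t; apply: cvgD; first exact: cvg_cst.
  by apply: cvgM; [exact: cvg_cst|exact: Vc].
have key eta : 0 < eta -> forall ij t, 0 <= t <= T -> 0 < z eta ij t.
  move=> eta0.
  have hist ij t : - r <= t <= 0 -> 0 < z eta ij t.
    move=> tr; have tr' : t \in `[- r, 0] by rewrite in_itv.
    have [xt yt] := init t tr'; have [psi0 phi0] := pp0 t tr'.
    have tT : t <= T by case/andP : tr => _ /le_trans; apply; exact: ltW.
    case: ij => [i|j]; rewrite /z /zx /zy.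
      by rewrite xt ltr_wpDl// mulr_gt0// (lt_le_trans ltr01)// w_ge1.
    by rewrite yt ltr_wpDl// mulr_gt0// mulr_gt0.
  apply: first_zero.
  - case=> [i|j] t; apply: cvgD.
    + exact: xic0.
    + apply: cvgM; first exact: cvg_cst.
      exact: (continuous_subspaceT (wc i)).
    + exact: yjc0.
    + apply: cvgM; first exact: cvg_cst.
      apply: cvgM; first exact: cvg_cst.
      exact: (continuous_subspaceT ec).
  - by move=> ij; apply: hist; rewrite lexx andbT oppr_le0 ltW.
  move=> t /andP[t0 tT] zge.
  have tT' : 0 <= t <= T by rewrite ltW.
  have tI : t \in `[0, T] by rewrite in_itv.
  have zge' ij s : - r <= s <= t -> 0 <= z eta ij s.
    move=> /andP[rs st]; have [s0|s0] := leP 0 s; first by rewrite zge// s0.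
    by apply: ltW; apply: hist; rewrite rs ltW.
  have lag tau : admissible_delay r T tau -> - r <= t - tau t <= t.
    by move=> [_ /(_ t tI)[tau0 ->]]; rewrite /= gerBl.
  have ft0 := (fg0 t tI).1; have gt0 := (fg0 t tI).2.
  (* the solution is the perturbed solution, whose sign is known up to t, minus the
     perturbation, whose size is known *)
  pose wv s : 'cV[R]_d := \col_i w i s.
  pose lv s : 'cV[R]_n := \col_(j < n) (L * e s).
  pose zxv s : 'cV[R]_d := \col_i zx eta i s.
  pose zyv s : 'cV[R]_n := \col_j zy eta j s.
  have xE s : x s = zxv s - eta *: wv s.
    by apply/colP => i; rewrite !mxE /zx addrK.
  have yE s : y s = zyv s - eta *: lv s.
    by apply/colP => i; rewrite !mxE /zy addrK.
  have Mx (m : nat) (M : 'M[R]_(m, d)) s i :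
      (M *m x s) i 0 = (M *m zxv s) i 0 - eta * (M *m wv s) i 0.
    by rewrite xE mulmxBr -scalemxAr; rewrite [LHS]mxE; congr (_ + _);
      rewrite [LHS]mxE; congr (- _); rewrite [LHS]mxE.
  have My (m : nat) (M : 'M[R]_(m, n)) s i :
      (M *m y s) i 0 = (M *m zyv s) i 0 - eta * (M *m lv s) i 0.
    by rewrite yE mulmxBr -scalemxAr; rewrite [LHS]mxE; congr (_ + _);
      rewrite [LHS]mxE; congr (- _); rewrite [LHS]mxE.
  have bw (m : nat) (M : 'M[R]_(m, d)) s i K : s <= t ->
      (forall i, \sum_k `|M i k| <= K) -> (M *m wv s) i 0 <= K * (2 * e t).
    move=> st MK; rewrite (le_trans (ler_norm _))//.
    rewrite (le_trans (@mulmx_bound R _ _ M (wv s) (2 * e t) i _))//.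
      move=> k; rewrite mxE ger0_norm; first exact: w_le.
      by rewrite (le_trans ler01)// w_ge1// (le_trans st).
    by rewrite ler_wpM2r// mulr_ge0// ltW.
  have bl (m : nat) (M : 'M[R]_(m, n)) s i K : s <= t ->
      (forall i, \sum_k `|M i k| <= K) -> (M *m lv s) i 0 <= K * (L * e t).
    move=> st MK; rewrite (le_trans (ler_norm _))//.
    have Ls : 0 <= L * e s by rewrite mulr_ge0// ltW.
    rewrite (le_trans (@mulmx_bound R _ _ M (lv s) (L * e t) i _))//.
      move=> k; rewrite mxE ger0_norm//; rewrite ler_wpM2l ?(ltW L0)//; exact: eM.
    by rewrite ler_wpM2r// mulr_ge0// ltW.
  have zx0 s : - r <= s <= t -> forall k, 0 <= zxv s k 0.
    by move=> sr k; rewrite mxE; exact: (zge' (inl k)).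
  have zy0 s : - r <= s <= t -> forall k, 0 <= zyv s k 0.
    by move=> sr k; rewrite mxE; exact: (zge' (inr k)).
  have tr : - r <= t <= t by rewrite lexx andbT; lra.
  pose s1 := t - tau1 t; pose s2 := t - tau2 t; pose s3 := t - tau3 t.
  have l1 : - r <= s1 <= t by exact: lag.
  have l2 : - r <= s2 <= t by exact: lag.
  have l3 : - r <= s3 <= t by exact: lag.
  case=> [i|j]; apply/eqP; rewrite /z.
  (* a state component: H is the Caputo derivative of zx eta i *)
  - move=> zi0.
    pose H s := (A *m x s + B *m x (s - tau1 s) + E *m y (s - tau2 s) + f s) i 0
      + eta * (N * e s).
    have HE s : H s = (A *m x s) i 0 + (B *m x (s - tau1 s)) i 0 +
        (E *m y (s - tau2 s)) i 0 + f s i 0 + eta * (N * e s) by rewrite /H !mxE.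
    have : H t <= 0.
      apply: (@caputo_le0_at_zero_min R T (alpha i) t (zx eta i) H) => //.
      + by rewrite t0.
      + move=> s; apply: cvgD; first exact: xic0.
        apply: cvgM; first exact: cvg_cst.
        exact: (continuous_subspaceT (wc i)).
      + have -> : H = (fun s => (A *m x s) i 0 + (B *m x (s - tau1 s)) i 0 +
            (E *m y (s - tau2 s)) i 0 + f s i 0 + eta * (N * e s)).
          exact/funext.
        move=> s; apply: cvgD; last first.
          apply: cvgM; first exact: cvg_cst.
          apply: cvgM; first exact: cvg_cst.
          exact: (continuous_subspaceT ec).
        apply: cvgD; last exact: (within_continuous_coord fc).
        apply: cvgD; last first.
          apply: (within_continuous_mulmx (x := fun s => y (s - tau2 s))) => k.
          exact: (within_continuous_delay ad2 (yjc k)).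
        apply: cvgD; first exact: (within_continuous_mulmx xic0).
        apply: (within_continuous_mulmx (x := fun s => x (s - tau1 s))) => k.
        exact: (within_continuous_delay ad1 (xic k)).
      + move=> s /andP[s0 sT]; have sT' : 0 <= s <= T by rewrite ltW.
        have sI : s \in `]0, T] by rewrite in_itv/= s0.
        have -> : zx eta i = (fun s => x s i 0 + eta * w i s) by [].
        apply: is_caputo_lin => //.
        * by case/andP : (a01 i).
        * exact: (continuous_subspaceT (wc i)).
        * exact: caputo.
        * rewrite -[N * e s]add0r; apply: is_caputo_lin => //.
          -- by case/andP : (a01 i).
          -- by move=> ?; exact: cvg_cst.
          -- exact: (continuous_subspaceT (Vc i)).
          -- exact: is_caputo_cst.
          -- by case: (UV i) => _ _ /(_ s); rewrite s0 sT => /(_ isT)[].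
      + by move=> s /andP[s0 st]; apply: (zge' (inl i)); rewrite st andbT; lra.
    have HtE : H t = (A *m x t) i 0 + (B *m x s1) i 0 + (E *m y s2) i 0 +
        f t i 0 + eta * (N * e t) by rewrite HE.
    apply/negP; rewrite -ltNge HtE !Mx My.
    have A1 := metzler_mulmx mA (zx0 t tr) (_ : zxv t i 0 = 0).
    have {}A1 : 0 <= (A *m zxv t) i 0 by apply: A1; rewrite mxE.
    have B1 := nonneg_mulmx i nB (zx0 _ l1).
    have E1 := nonneg_mulmx i nE (zy0 _ l2).
    have A2 := bw _ A t i KA (lexx _) KAP.
    have B2 := bw _ B s1 i KB (proj2 (andP l1)) KBP.
    have E2 := bl _ E s2 i KE (proj2 (andP l2)) KEP.
    have f0 := ft0 i 0.
    move: A1 B1 E1 A2 B2 E2 f0; clear -eta0 e0.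
    move: (e0 t); generalize (e t) ((A *m zxv t) i 0) ((B *m zxv s1) i 0)
      ((E *m zyv s2) i 0) ((A *m wv t) i 0) ((B *m wv s1) i 0)
      ((E *m lv s2) i 0) (f t i 0).
    clear -eta0 => u a b c a' b' c' f u0 *.
    have : 0 < eta * (N * u - (a' + b' + c')) by rewrite mulr_gt0// /N; lra.
    lra.
  - apply/eqP; rewrite gt_eqF//.
    have -> : zy eta j t = (C *m x t) j 0 + (D *m y s3) j 0 + g t j 0 +
        eta * (L * e t).
      by rewrite /zy (alg t tI) [in LHS]mxE [in LHS]mxE.
    rewrite Mx My.
    have C1 := nonneg_mulmx j nC (zx0 t tr).
    have D1 := nonneg_mulmx j nD (zy0 _ l3).
    have C2 := bw _ C t j KC (lexx _) KCP.
    have D2 := bl _ D s3 j rho (proj2 (andP l3)) rhoP.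
    have g0 := gt0 j 0.
    move: C1 D1 C2 D2 g0; clear -eta0 e0 LE.
    move: (e0 t); generalize (e t) ((C *m zxv t) j 0) ((D *m zyv s3) j 0)
      ((C *m wv t) j 0) ((D *m lv s3) j 0) (g t j 0).
    clear -eta0 LE => u a b a' b' g u0 *.
    have : L * (1 - rho) * u = (2 * KC + 1) * u by rewrite LE.
    move=> ?; have : 0 < eta * (L * u - (a' + b')) by rewrite mulr_gt0//; lra.
    lra.
move=> t; rewrite in_itv/= => tT; split=> i j; rewrite (ord1 j).
  by apply: (@ge0_of_small_perturb _ (w i t)) => eta /key/(_ (inl i) t tT).
by apply: (@ge0_of_small_perturb _ (L * e t)) => eta /key/(_ (inr i) t tT).
Qed.

End Sufficiency.

(** * Positivity implies the sign conditions *)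

Section Necessity.
Context {R : realType}.

Lemma is_caputo_eq T a (u v : R -> R) t l : 0 <= t <= T ->
  (forall s, 0 <= s <= T -> u s = v s) ->
  is_caputo T a u t l -> is_caputo T a v t l.
Proof.
move=> tT uv; apply: is_derive_on_eq => // s /andP[s0 sT].
have T0 : 0 <= T by exact: le_trans sT.
apply: frac_int_eq => // q /andP[q0 qs].
by rewrite !uv ?lexx// q0 (le_trans qs).
Qed.

(** Equal to 1 before - b and to 0 from 0 on: it interpolates between the values of
    the history seen through the delays at early times and the values at 0. *)
Definition ramp (b s : R) : R := Num.min 1 (Num.max 0 (- s / b)).

Lemma ramp_itv b s : 0 <= ramp b s <= 1.
Proof. by rewrite /ramp le_min ler01 le_max lexx ge_min lexx. Qed.

Lemma ramp_ge0 b s : 0 < b -> 0 <= s -> ramp b s = 0.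
Proof.
move=> b0 s0; rewrite /ramp max_l ?min_r//.
by rewrite mulNr oppr_le0 divr_ge0// ltW.
Qed.

Lemma ramp_le b s : 0 < b -> s <= - b -> ramp b s = 1.
Proof.
move=> b0 sb; rewrite /ramp min_l// le_max; apply/orP; right.
by rewrite ler_pdivlMr// mul1r lerNr.
Qed.

Lemma continuous_ramp b : continuous (ramp b).
Proof.
move=> s.
apply: (@continuous_min R R (fun=> (1 : R)) (fun s => Num.max (0 : R) (- s / b)) s).
  exact: cvg_cst.
apply: (@continuous_max R R (fun=> (0 : R)) (fun s => - s / b : R) s).
  exact: cvg_cst.
by apply: cvgM; [apply: cvgN; exact: cvg_id|exact: cvg_cst].
Qed.

Lemma convex_comb_le (p q k c : R) : 0 <= k <= 1 -> 0 <= p <= c -> 0 <= q <= c ->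
  0 <= p * k + q * (1 - k) <= c.
Proof.
move=> /andP[k0 k1] /andP[p0 pc] /andP[q0 qc].
have k1' : 0 <= 1 - k by rewrite subr_ge0.
rewrite addr_ge0 ?mulr_ge0//=.
rewrite (@le_trans _ _ (c * k + c * (1 - k)))// ?lerD ?ler_wpM2r//.
by rewrite -mulrDr addrC subrK mulr1.
Qed.

(** Any continuous function bounded by 1 would do that is null for t <= 0 and
    positive for t > 0. *)
Definition soft_step (t : R) : R := 1 - ramp 1 (t - 1).

Lemma soft_step_itv t : 0 <= soft_step t <= 1.
Proof.
have /andP[? ?] := ramp_itv 1 (t - 1).
by rewrite /soft_step; apply/andP; split; lra.
Qed.

Lemma soft_step_le0 t : t <= 0 -> soft_step t = 0.
Proof. by move=> t0; rewrite /soft_step ramp_le ?subrr//; lra. Qed.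

Lemma soft_step_gt0 t : 0 < t -> 0 < soft_step t.
Proof.
move=> t0; rewrite /soft_step subr_gt0 /ramp gt_min; apply/orP; right.
by rewrite gt_max ltr01/= divr1; lra.
Qed.

Lemma continuous_soft_step : continuous soft_step.
Proof.
move=> t; apply: cvgB; first exact: cvg_cst.
apply: (@cvg_comp _ _ _ (fun t => t - 1) (ramp 1) _ (nbhs (t - 1))).
  by apply: cvgB; [exact: cvg_id|exact: cvg_cst].
exact: continuous_ramp.
Qed.

Lemma norm_excess_le (N G sg c u v : R) : 0 <= u <= v -> N * v <= c ->
  0 <= G <= 1 -> 1 <= N -> 0 <= sg <= N + G -> `|N * v - sg * u| <= c.
Proof.
move=> /andP[u0 uv] vc /andP[G0 G1] N1 /andP[sg0 sgN].
have su : sg * u <= (N + G) * u by rewrite ler_wpM2r.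
have su0 : 0 <= sg * u by rewrite mulr_ge0.
have Gu : G * u <= u by rewrite ler_piMl.
have Nu : N * u <= N * v by rewrite ler_wpM2l// (le_trans ler01).
have vN : v <= N * v by rewrite ler_peMl// (le_trans u0).
rewrite mulrDl in su; rewrite ler_norml.
move: (N * v) (N * u) (G * u) (sg * u) su su0 Gu Nu vN vc => ? ? ? ? *.
by apply/andP; split; lra.
Qed.

Lemma norm_saturated_le (L nu e e' s : R) : 1 <= L -> 1 <= e <= e' ->
  0 <= nu <= 1 -> 0 <= s <= 1 ->
  `|L * (e - 1) - nu * s| <= L * e'.
Proof.
move=> L1 /andP[e1 ee] /andP[nu0 nu1] /andP[s0 s1].
have n0 : 0 <= nu * s by rewrite mulr_ge0.
have n1 : nu * s <= 1 by rewrite mulr_ile1.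
have L0 : 0 <= L by rewrite (le_trans ler01).
have h1 : L * e <= L * e' by rewrite ler_wpM2l.
have h2 : L * 1 <= L * e by rewrite ler_wpM2l.
rewrite mulrBr mulr1 ler_norml; rewrite mulr1 in h2.
move: (L * e) (L * e') (nu * s) n0 n1 h1 h2 => ? ? ? *.
by apply/andP; split; lra.
Qed.

(** On the initial interval: the margin gamma of the drive a pays for the constant
    G, which makes the component decrease, and for the error k, as long as e is
    close to 1; the growth N (e - 1) takes over as e grows. *)
Lemma early_drive_ge0 (N G gamma e a k : R) : 0 <= G <= 1 -> 1 <= N -> 1 <= e ->
  4 * G <= gamma -> a <= - gamma -> k <= G * e -> 0 <= N * e - (N + G) - a - k.
Proof.
move=> /andP[G0 G1] N1 e1 Gg ag ke.
have : 0 <= (N - G) * (e - 1) by rewrite mulr_ge0// subr_ge0// (le_trans G1).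
rewrite mulrBl !mulrBr !mulr1; lra.
Qed.

(** After the initial interval: the growth alone dominates the coupling terms k. *)
Lemma late_drive_ge0 (K G e k : R) : 0 <= K -> G <= 1 -> 6 <= e -> k <= K * e ->
  0 <= (2 * K + 4) * e - (2 * K + 4 + G) - k.
Proof.
move=> K0 G1 e6 ke; have Ke : K * 6 <= K * e by rewrite ler_wpM2l.
rewrite mulrDl -mulrA; lra.
Qed.

Lemma delay_initial_lag r T (tau : R -> R) : 0 < T -> admissible_delay r T tau ->
  0 < tau 0 -> exists2 b, 0 < b & exists2 c, 0 < c &
    forall t, 0 <= t <= T -> t <= c -> t - tau t <= - b.
Proof.
move=> T0 [tc _] tau0; pose b := tau 0 / 4.
have b0 : 0 < b by rewrite divr_gt0.
have T00 : (0 : R) <= 0 <= T by apply/andP; split; [exact: lexx|exact: ltW].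
have [c c0 cP] := (within_continuousE 0 T tau).1 tc 0 T00 b b0.
exists b => //; exists (Num.min (c / 2) b); first by rewrite lt_min b0 divr_gt0.
move=> t tT; rewrite le_min => /andP[tc' tb].
have := cP t tT; rewrite subr0 ger0_norm; last by case/andP : tT.
have -> : t < c by lra.
move=> /(_ isT); rewrite ltr_norml => /andP[h _]; move: h tb tau0; rewrite /b; clear; lra.
Qed.

(** The state starts at q and the output at L, except for the output components in
    sy, which start at 0; the delays see p and p' at early times.  For t >= 0 the
    state is q + N V, with Caputo derivative N e, and the output is L e.  In the
    components in sx this derivative is lowered to N (e - 1) - G, and the output
    components in sy are L (e - 1) - G soft_step: both vanish at 0 and are negative
    on ]0, dl], where e = 1.  Since V is small compared with e, all other terms of
    the equations are controlled by e, and f and g, defined by the equations, are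
    nonnegative.  The set-valued form with sx and sy treats the signs of A, B, E
    and those of C, D by the same construction. *)
Lemma no_negative_drive (d n : nat) (r T : R) (alpha : 'I_d -> R)
    (A B : 'M[R]_d) (E : 'M[R]_(d, n)) (C : 'M[R]_(n, d)) (D : 'M[R]_n)
    (tau1 tau2 tau3 : R -> R) (p q : 'cV[R]_d) (p' : 'cV[R]_n)
    (sx : pred 'I_d) (sy : pred 'I_n) (gamma : R) :
  0 < T -> (forall i, 0 < alpha i <= 1) ->
  (forall i, \sum_(k < d) `|C i k| < 1) ->
  (forall i, \sum_(j < n) `|D i j| < 1) ->
  admissible_delay r T tau1 -> admissible_delay r T tau2 ->
  admissible_delay r T tau3 ->
  0 < tau1 0 -> 0 < tau2 0 -> 0 < tau3 0 ->
  positive_system r T alpha A B E C D tau1 tau2 tau3 ->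
  (forall i, 0 <= p i 0 <= 1) -> (forall i, 0 <= q i 0 <= 1) ->
  (forall j, 0 <= p' j 0 <= 1) -> 0 < gamma ->
  (forall i, sx i -> q i 0 = 0 /\
    (A *m q) i 0 + (B *m p) i 0 + (E *m p') i 0 <= - gamma) ->
  (forall j, sy j -> (C *m q) j 0 + (D *m p') j 0 <= - gamma) ->
  (forall i, ~~ sx i) /\ (forall j, ~~ sy j).
Proof.
move=> T0 a01 rowC rowD ad1 ad2 ad3 t10 t20 t30 pos p01 q01 p'01 gamma0 sxP syP.
have [rho /andP[rho0 rho1] rhoP] := rowsum_bound_lt ltr01 rowD.
have [KA KA0 KAP] := rowsum_bound A; have [KB KB0 KBP] := rowsum_bound B.
have [KE KE0 KEP] := rowsum_bound E.
have rho1' : 0 < 1 - rho by rewrite subr_gt0.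
(* L e - rho L e = 6 e covers C x, which is at most 2 e, with a margin *)
pose L := 6 / (1 - rho).
have LE : L * (1 - rho) = 6 by rewrite /L divfK// gt_eqF.
have L6 : 6 <= L by rewrite /L ler_pdivlMr// ler_piMr// lerBlDr lerDl.
have L0 : 0 < L by lra.
have L1 : 1 <= L by lra.
clearbody L.
pose K := 2 * KA + 2 * KB + KE * L.
have K0 : 0 <= K by rewrite !addr_ge0// mulr_ge0// ltW.
pose N := 2 * K + 4.
have N1 : 1 <= N by rewrite /N; lra.
have N0 : 0 < N by lra.
have N_ge0 := ltW N0.
pose G := Num.min 1 (gamma / 4).
have G0 : 0 < G by rewrite lt_min ltr01 divr_gt0.
have G1 : G <= 1 by rewrite ge_min lexx.
have Gg : 4 * G <= gamma.
  have : G <= gamma / 4 by rewrite ge_min lexx orbT.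
  by clear; lra.
have G_ge0 := ltW G0.
clearbody G.
(* the bound on N V / e: both V itself and its image under A cost at most G e *)
pose eta := G / (1 + KA).
have KA1 : 0 < 1 + KA by rewrite ltr_wpDr.
have eta0 : 0 < eta by rewrite divr_gt0.
have etaG : eta <= G by rewrite /eta ler_pdivrMr// ler_peMr// lerDl.
have KAeta : KA * eta <= G.
  by rewrite /eta mulrA ler_pdivrMr// mulrC ler_wpM2l// lerDr.
clearbody eta.
have [b1 b10 [c1 c10 lag1]] := delay_initial_lag T0 ad1 t10.
have [b2 b20 [c2 c20 lag2]] := delay_initial_lag T0 ad2 t20.
have [b3 b30 [c3 c30 lag3]] := delay_initial_lag T0 ad3 t30.
pose b := Num.min b1 (Num.min b2 b3).
have b0 : 0 < b by rewrite !lt_min b10 b20.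
have bb1 : b <= b1 by rewrite ge_min lexx.
have bb2 : b <= b2 by rewrite !ge_min lexx orbT.
have bb3 : b <= b3 by rewrite !ge_min lexx !orbT.
pose D0 := Num.min c1 (Num.min c2 c3) / 2.
have cmin0 : 0 < Num.min c1 (Num.min c2 c3) by rewrite !lt_min c10 c20.
have D00 : 0 < D0 by rewrite divr_gt0.
have epsN0 : 0 < eta / N by rewrite divr_gt0.
have [dl [lam [U [V [/andP[dl0 dlD] lam0 lamB UV]]]]] :=
  @comparison_functions R d alpha T (eta / N) D0 L a01 epsN0 D00.
have early t : t <= dl *+ 2 -> [/\ t <= c1, t <= c2 & t <= c3].
  rewrite mulr2n => tdl; have tm : t <= Num.min c1 (Num.min c2 c3).
    by rewrite (le_trans tdl)//; move: dlD; rewrite /D0; clear; lra.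
  by move: tm; rewrite !le_min => /and3P[].
set e := delayed_exp lam dl in UV.
have ec : continuous e := @continuous_delayed_exp R lam dl.
have e1 t : 1 <= e t := delayed_exp_ge1 dl t lam0.
have e_ge0 t : 0 <= e t by exact: le_trans (e1 t).
have eM s t : s <= t -> e s <= e t by exact: delayed_exp_homo.
have e_early t : t <= dl -> e t = 1 by exact: delayed_exp1.
have e_late t : dl *+ 2 <= t -> L <= e t.
  move=> tdl; rewrite (le_trans lamB)// /e /delayed_exp ler_expR ler_wpM2l//.
  by rewrite le_max; apply/orP; right; rewrite lerBrDl -mulr2n.
clearbody e.
have Uc i : continuous (U i) by case: (UV i) => -[].
have Vc i : continuous (V i) by case: (UV i) => -[].
have UV0 i t : t <= 0 -> U i t = 0 /\ V i t = 0 by case: (UV i) => _ /(_ t) h _ _ _ /h[].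
have UVcap i t : 0 < t <= T -> is_caputo T (alpha i) (U i) t 1 /\
    is_caputo T (alpha i) (V i) t (e t).
  by case: (UV i) => _ _ h _ _; exact: h.
have UVearly i t : 0 < t <= dl -> 0 < U i t /\ V i t = U i t.
  by case: (UV i) => _ _ _ h _; exact: h.
have UVb i t : 0 <= t <= T -> [/\ 0 <= U i t, U i t <= V i t & N * V i t <= eta * e t].
  case: (UV i) => _ _ _ _ h /h[? ? vt]; split=> //.
  by rewrite mulrC -ler_pdivlMr// mulrAC.
clear UV.
(* the deviations from the regular behaviour in the distinguished components *)
pose sg i := if sx i then N + G else 0.
pose nu j := if sy j then G else 0.
pose Q j := if sy j then 0 else L.
pose X i t := N * V i t - sg i * U i t.
pose Y j t := L * (e t - 1) - nu j * soft_step t.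
pose x t : 'cV[R]_d := \col_i (p i 0 * ramp b t + q i 0 * (1 - ramp b t) + X i t).
pose y t : 'cV[R]_n := \col_j (p' j 0 * ramp b t + Q j * (1 - ramp b t) + Y j t).
have Xb i t : 0 <= t <= T -> `|X i t| <= eta * e t.
  move=> tT; have [u0 uv vt] := UVb i t tT.
  apply: (@norm_excess_le N G); rewrite ?u0 ?G_ge0//.
  by rewrite /sg; case: ifP => _; rewrite lexx addr_ge0.
have X_le0 i t : t <= 0 -> X i t = 0.
  by move=> t0; rewrite /X; have [-> ->] := UV0 i t t0; rewrite !mulr0 subr0.
have Y_le0 j t : t <= 0 -> Y j t = 0.
  move=> t0; rewrite /Y soft_step_le0// e_early ?(le_trans t0) ?ltW//.
  by rewrite subrr !mulr0 subr0.
have Q0L j : 0 <= Q j <= L by rewrite /Q; case: ifP => _; rewrite lexx ltW.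
have x_ge0 t k : 0 <= t -> x t k 0 = q k 0 + X k t.
  by move=> t0; rewrite mxE ramp_ge0// mulr0 add0r subr0 mulr1.
have y_ge0 t j : 0 <= t -> y t j 0 = Q j + Y j t.
  by move=> t0; rewrite mxE ramp_ge0// mulr0 add0r subr0 mulr1.
have x_le0 t k : t <= 0 -> 0 <= x t k 0 <= 1.
  move=> t0; rewrite mxE X_le0// addr0.
  by apply: convex_comb_le; rewrite ?ramp_itv.
have y_le0 t j : t <= 0 -> 0 <= y t j 0 <= L.
  move=> t0; rewrite mxE Y_le0// addr0; apply: convex_comb_le; rewrite ?ramp_itv//.
  by have /andP[-> h] := p'01 j; rewrite (le_trans h)//; lra.
have x_hist t : t <= - b -> x t = p.
  move=> tb; have t0 : t <= 0 by rewrite (le_trans tb)// oppr_le0 ltW.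
  by apply/colP => k; rewrite mxE ramp_le// X_le0// subrr mulr0 mulr1 !addr0.
have y_hist t : t <= - b -> y t = p'.
  move=> tb; have t0 : t <= 0 by rewrite (le_trans tb)// oppr_le0 ltW.
  by apply/colP => k; rewrite mxE ramp_le// Y_le0// subrr mulr0 mulr1 !addr0.
have xb s t k : s <= t -> t <= T -> `|x s k 0| <= 2 * e t.
  move=> st tT; have et := e1 t.
  have [s0|s0] := leP s 0.
    by have /andP[h1 h2] := x_le0 s k s0; rewrite ger0_norm//; move: h2 et; clear; lra.
  rewrite (x_ge0 _ _ (ltW s0)) (le_trans (ler_normD _ _))//.
  have sT : 0 <= s <= T by rewrite ltW//= (le_trans st).
  have hX := Xb k s sT; have es := eM s t st.
  have h3 : eta * e s <= e t.
    by rewrite (le_trans _ es)// ler_piMl// (le_trans etaG).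
  have /andP[h1 h2] := q01 k; rewrite (ger0_norm h1).
  by move: hX h3 h2 et; clear; lra.
have yb s t k : s <= t -> `|y s k 0| <= L * e t.
  move=> st; have et := e1 t; have es := e1 s; have est := eM s t st.
  have Let : L <= L * e t by rewrite ler_peMr// ltW.
  have [s0|s0] := leP s 0.
    by have /andP[h1 h2] := y_le0 s k s0; rewrite ger0_norm// (le_trans h2).
  rewrite (y_ge0 _ _ (ltW s0)) /Q /Y /nu; case: ifP => _.
    by rewrite add0r norm_saturated_le ?L1 ?es ?G_ge0 ?soft_step_itv.
  rewrite mul0r subr0 mulrBr mulr1 addrC subrK ger0_norm; first by rewrite ler_wpM2l// ltW.
  by rewrite mulr_ge0// ltW.
(* h is the Caputo derivative of x; the equations dictate f and g *)
pose h t : 'cV[R]_d := \col_i (N * e t - sg i).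
pose f t : 'cV[R]_d := h t - A *m x t - B *m x (t - tau1 t) - E *m y (t - tau2 t).
pose g t : 'cV[R]_n := y t - C *m x t - D *m y (t - tau3 t).
have xkc k : continuous (fun t => x t k 0).
  have -> : (fun t => x t k 0) = (fun t => p k 0 * ramp b t +
      q k 0 * (1 - ramp b t) + (N * V k t - sg k * U k t)).
    by apply/funext => t; rewrite mxE.
  move=> t; apply: cvgD; first apply: cvgD.
  - by apply: cvgM; [exact: cvg_cst|exact: continuous_ramp].
  - apply: cvgM; first exact: cvg_cst.
    by apply: cvgB; [exact: cvg_cst|exact: continuous_ramp].
  - by apply: cvgB; apply: cvgM; try exact: cvg_cst; [exact: Vc|exact: Uc].
have ykc k : continuous (fun t => y t k 0).
  have -> : (fun t => y t k 0) = (fun t => p' k 0 * ramp b t +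
      Q k * (1 - ramp b t) + (L * (e t - 1) - nu k * soft_step t)).
    by apply/funext => t; rewrite mxE.
  move=> t; apply: cvgD; first apply: cvgD.
  - by apply: cvgM; [exact: cvg_cst|exact: continuous_ramp].
  - apply: cvgM; first exact: cvg_cst.
    by apply: cvgB; [exact: cvg_cst|exact: continuous_ramp].
  - apply: cvgB; apply: cvgM; try exact: cvg_cst; last exact: continuous_soft_step.
    by apply: cvgB; [exact: ec|exact: cvg_cst].
have xW (S : set R) : {within S, continuous x}.
  apply: within_continuous_mx => i j; rewrite (ord1 j).
  exact: (continuous_subspaceT (xkc i)).
have yW (S : set R) : {within S, continuous y}.
  apply: within_continuous_mx => i j; rewrite (ord1 j).
  exact: (continuous_subspaceT (ykc i)).
have xdelay tau k : admissible_delay r T tau ->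
    {within `[0, T], continuous (fun t => x (t - tau t) k 0)}.
  move=> ad; apply: (@within_continuous_delay R r T tau (fun t => x t k 0) ad).
  exact: (continuous_subspaceT (xkc k)).
have ydelay tau k : admissible_delay r T tau ->
    {within `[0, T], continuous (fun t => y (t - tau t) k 0)}.
  move=> ad; apply: (@within_continuous_delay R r T tau (fun t => y t k 0) ad).
  exact: (continuous_subspaceT (ykc k)).
have fE t i : f t i 0 = N * e t - sg i - (A *m x t) i 0 -
    (B *m x (t - tau1 t)) i 0 - (E *m y (t - tau2 t)) i 0.
  rewrite /f; do 3 (rewrite [LHS]mxE; congr (_ + _); last by rewrite mxE).
  by rewrite mxE.
have gE t j : g t j 0 = y t j 0 - (C *m x t) j 0 - (D *m y (t - tau3 t)) j 0.
  by rewrite /g; do 2 (rewrite [LHS]mxE; congr (_ + _); last by rewrite mxE).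
clearbody f g.
have fc : {within `[0, T], continuous f}.
  apply: within_continuous_mx => i j; rewrite (ord1 j).
  rewrite (funext (fE ^~ i)) => t; apply: cvgB; first apply: cvgB; first apply: cvgB.
  - apply: cvgB; last exact: cvg_cst.
    apply: cvgM; first exact: cvg_cst.
    exact: (continuous_subspaceT ec).
  - by apply: within_continuous_mulmx => k; exact: (continuous_subspaceT (xkc k)).
  - by apply: (within_continuous_mulmx (x := fun s => x (s - tau1 s))) => k; exact: xdelay.
  - by apply: (within_continuous_mulmx (x := fun s => y (s - tau2 s))) => k; exact: ydelay.
have gc : {within `[0, T], continuous g}.
  apply: within_continuous_mx => i j; rewrite (ord1 j).
  rewrite (funext (gE ^~ i)) => t; apply: cvgB; first apply: cvgB.
  - exact: (continuous_subspaceT (ykc i)).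
  - by apply: within_continuous_mulmx => k; exact: (continuous_subspaceT (xkc k)).
  - by apply: (within_continuous_mulmx (x := fun s => y (s - tau3 s))) => k; exact: ydelay.
have sol : is_solution r T alpha A B E C D tau1 tau2 tau3 f g x y x y.
  split; [by split; [exact: xW|exact: yW]|by []| |].
  - move=> t; rewrite in_itv/= => tT i.
    have tT' : 0 <= t <= T by case/andP : tT => /ltW-> ->.
    have [cU cV] := UVcap i t tT.
    have ai1 : alpha i <= 1 by case/andP : (a01 i).
    have cx : is_caputo T (alpha i) (fun s => q i 0 + N * V i s + (- sg i) * U i s) t
        (0 + N * e t + (- sg i) * 1).
      apply: is_caputo_lin => //; last apply: is_caputo_lin => //.
      + move=> s; apply: cvgD; first exact: cvg_cst.
        apply: cvgM; first exact: cvg_cst.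
        exact: (continuous_subspaceT (Vc i)).
      + exact: (continuous_subspaceT (Uc i)).
      + by move=> s; exact: cvg_cst.
      + exact: (continuous_subspaceT (Vc i)).
      + exact: is_caputo_cst.
    have -> : (A *m x t + B *m x (t - tau1 t) + E *m y (t - tau2 t) + f t) i 0 =
        0 + N * e t + (- sg i) * 1.
      have addE (a c : 'cV[R]_d) : (a + c) i 0 = a i 0 + c i 0 by rewrite mxE.
      by rewrite !addE fE; ring.
    apply: is_caputo_eq cx => // s /andP[s0 _].
    by rewrite x_ge0// /X mulNr addrA.
  - by move=> t _; apply/colP => j; rewrite [RHS]mxE gE [X in _ = X + _]mxE; ring.
have fg0 t : t \in `[0, T] -> nonneg_mx (f t) /\ nonneg_mx (g t).
  rewrite in_itv/= => tT; have /andP[t0 tT2] := tT.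
  have tI : t \in `[0, T] by rewrite in_itv.
  pose s1 := t - tau1 t; pose s2 := t - tau2 t; pose s3 := t - tau3 t.
  have lag tau : admissible_delay r T tau -> t - tau t <= t.
    by move=> [_ /(_ t tI)[tau0 _]]; rewrite gerBl.
  have l1 : s1 <= t by exact: lag.
  have l2 : s2 <= t by exact: lag.
  have l3 : s3 <= t by exact: lag.
  have e_ge0t := e_ge0 t; have e1t := e1 t.
  have bx (m : nat) (M : 'M[R]_(m, d)) KM s i : s <= t ->
      (forall i, \sum_k `|M i k| <= KM) -> `|(M *m x s) i 0| <= KM * (2 * e t).
    move=> st MK; rewrite (le_trans (@mulmx_bound R _ _ M (x s) (2 * e t) i _))//.
      by move=> k; exact: xb.
    by rewrite ler_wpM2r// mulr_ge0.
  have bY (m : nat) (M : 'M[R]_(m, n)) KM s i : s <= t ->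
      (forall i, \sum_k `|M i k| <= KM) -> `|(M *m y s) i 0| <= KM * (L * e t).
    move=> st MK; rewrite (le_trans (@mulmx_bound R _ _ M (y s) (L * e t) i _))//.
      by move=> k; exact: yb.
    by rewrite ler_wpM2r// mulr_ge0// ltW.
  pose Xv : 'cV[R]_d := \col_k X k t.
  have bX (m : nat) (M : 'M[R]_(m, d)) KM i :
      (forall i, \sum_k `|M i k| <= KM) -> `|(M *m Xv) i 0| <= KM * (eta * e t).
    move=> MK; rewrite (le_trans (@mulmx_bound R _ _ M Xv (eta * e t) i _))//.
      by move=> k; rewrite mxE; exact: Xb.
    by rewrite ler_wpM2r// mulr_ge0// ltW.
  have xq (m : nat) (M : 'M[R]_(m, d)) i :
      (M *m x t) i 0 = (M *m q) i 0 + (M *m Xv) i 0.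
    have -> : x t = q + Xv by apply/colP => k; rewrite x_ge0// !mxE.
    by rewrite mulmxDr mxE.
  have rowC1 i : \sum_k `|C i k| <= 1 by exact: ltW.
  split=> i j; rewrite (ord1 j).
  - have -> : f t i 0 = N * e t - sg i -
        ((A *m x t) i 0 + (B *m x s1) i 0 + (E *m y s2) i 0) by rewrite fE; ring.
    have kA := le_trans (ler_norm _) (bx _ A KA t i (lexx t) KAP).
    have kB := le_trans (ler_norm _) (bx _ B KB s1 i l1 KBP).
    have kE := le_trans (ler_norm _) (bY _ E KE s2 i l2 KEP).
    have kK : (A *m x t) i 0 + (B *m x s1) i 0 + (E *m y s2) i 0 <= K * e t.
      have -> : K * e t = KA * (2 * e t) + KB * (2 * e t) + KE * (L * e t).
        by rewrite /K; ring.
      by rewrite lerD// lerD.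
    rewrite /sg; case: ifPn => [si|_]; last first.
      rewrite subr0 subr_ge0 (le_trans kK)// ler_wpM2r//.
      by rewrite /N; move: K0; clear; lra.
    have [tdl|tdl] := leP t (dl *+ 2); last first.
      by apply: late_drive_ge0 => //; rewrite (le_trans L6)// e_late// ltW.
    have [tc1 tc2 _] := early t tdl.
    have -> : x s1 = p by apply: x_hist; rewrite (le_trans (lag1 t tT tc1))// lerN2.
    have -> : y s2 = p' by apply: y_hist; rewrite (le_trans (lag2 t tT tc2))// lerN2.
    have [_ drive] := sxP i si.
    have kX := le_trans (ler_norm _) (bX _ A KA i KAP).
    set a := (A *m q) i 0 + (B *m p) i 0 + (E *m p') i 0 in drive.
    have -> : (A *m x t) i 0 + (B *m p) i 0 + (E *m p') i 0 = a + (A *m Xv) i 0.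
      by rewrite xq /a; ring.
    rewrite [- (a + _)]opprD addrA; apply: (@early_drive_ge0 N G gamma) => //.
      by rewrite G_ge0.
    by rewrite (le_trans kX)// mulrA ler_wpM2r.
  - have -> : g t i 0 = y t i 0 - ((C *m x t) i 0 + (D *m y s3) i 0) by rewrite gE; ring.
    rewrite y_ge0// /Q /Y /nu.
    have kC := le_trans (ler_norm _) (bx _ C 1 t i (lexx t) rowC1).
    have kD := le_trans (ler_norm _) (bY _ D rho s3 i l3 rhoP).
    have Le6 : L * e t - rho * (L * e t) = 6 * e t by rewrite -LE; ring.
    case: ifPn => [sj|_]; last first.
      have -> : L + (L * (e t - 1) - 0 * soft_step t) = L * e t by ring.
      move: kC kD Le6 e1t; clear; lra.
    have /andP[m0 m1] := soft_step_itv t.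
    have Gm0 : G * soft_step t <= G by rewrite ler_piMr.
    have [tdl|tdl] := leP t (dl *+ 2); last first.
      have eL := e_late t (ltW tdl).
      rewrite mulrBr; move: kC kD Le6 e1t eL Gm0 G1 L6; clear; lra.
    have [_ _ tc3] := early t tdl.
    have yp : y s3 = p' by apply: y_hist; rewrite (le_trans (lag3 t tT tc3))// lerN2.
    have drive := syP i sj; set a := (C *m q) i 0 + (D *m p') i 0 in drive.
    have -> : (C *m x t) i 0 + (D *m y s3) i 0 = a + (C *m Xv) i 0.
      by rewrite xq yp /a; ring.
    have kX := le_trans (ler_norm _) (bX _ C 1 i rowC1).
    have : 0 <= L * e t - (L + G) - a - (C *m Xv) i 0.
      apply: (@early_drive_ge0 L G gamma) => //; first by rewrite G_ge0.
      by rewrite (le_trans kX)// mul1r ler_wpM2r.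
    rewrite mulrBr; move: Gm0; clear; lra.
have pp0 t : t \in `[- r, 0] -> nonneg_mx (x t) /\ nonneg_mx (y t).
  rewrite in_itv/= => /andP[_ t0]; split=> i j; rewrite (ord1 j).
    by case/andP : (x_le0 t i t0).
  by case/andP : (y_le0 t i t0).
have comp : compatible C D tau3 g x y.
  rewrite /compatible; apply/colP => j; rewrite [LHS]mxE gE [X in X + _ = _]mxE sub0r; ring.
have xy0 := pos f g x y fc gc (xW _) (yW _) fg0 pp0 comp x y sol.
pose t := Num.min dl T.
have t0 : 0 < t by rewrite lt_min dl0.
have tdl : t <= dl by rewrite ge_min lexx.
have tT : t <= T by rewrite ge_min lexx orbT.
have [xt yt] : nonneg_mx (x t) /\ nonneg_mx (y t).
  by apply: xy0; rewrite in_itv/= ltW.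
split=> [i|j]; apply/negP => s_.
- have := xt i 0; rewrite (x_ge0 _ _ (ltW t0)) (sxP i s_).1 add0r.
  have -> : X i t = N * V i t - (N + G) * U i t by rewrite /X /sg s_.
  have [|u0 ->] := UVearly i t; first by rewrite t0.
  have -> : N * U i t - (N + G) * U i t = - (G * U i t) by ring.
  by rewrite oppr_ge0 leNgt mulr_gt0.
- have := yt j 0; rewrite (y_ge0 _ _ (ltW t0)).
  have -> : Q j = 0 by rewrite /Q s_.
  have -> : Y j t = - (G * soft_step t).
    by rewrite /Y /nu s_ e_early// subrr mulr0 sub0r.
  by rewrite add0r oppr_ge0 leNgt mulr_gt0// soft_step_gt0.
Qed.

End Necessity.
Theorem theorem4p3 (R : realType) (d n : nat) (r T : R) (alpha : 'I_d -> R)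
    (A B : 'M[R]_d) (E : 'M[R]_(d, n)) (C : 'M[R]_(n, d)) (D : 'M[R]_n)
    (r_gt0 : 0 < r) (T_gt0 : 0 < T)
    (alpha_01 : forall i, 0 < alpha i <= 1)
    (rowsum_C : forall i, \sum_(k < d) `|C i k| < 1)
    (rowsum_D : forall i, \sum_(j < n) `|D i j| < 1) :
  (exists tau1 tau2 tau3 : R -> R,
    [/\ admissible_delay r T tau1, admissible_delay r T tau2 &
        admissible_delay r T tau3] /\
    [/\ 0 < tau1 0, 0 < tau2 0 & 0 < tau3 0] /\
    positive_system r T alpha A B E C D tau1 tau2 tau3) ->
  [/\ metzler A, nonneg_mx B, nonneg_mx C, nonneg_mx D & nonneg_mx E] /\
  (forall tau1 tau2 tau3 : R -> R,
    admissible_delay r T tau1 -> admissible_delay r T tau2 ->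
    admissible_delay r T tau3 ->
    positive_system r T alpha A B E C D tau1 tau2 tau3).
Proof.
move=> [tau1 [tau2 [tau3 [[ad1 ad2 ad3] [[t10 t20 t30] pos]]]]].
have unit_itv m (k l : 'I_m) : 0 <= (delta_mx k 0 : 'cV[R]_m) l 0 <= 1.
  by rewrite mxE ler0n lern1 leq_b1.
have zero_itv m (l : 'I_m) : 0 <= (0 : 'cV[R]_m) l 0 <= 1.
  by rewrite mxE lexx ler01.
have drive_state (p q : 'cV[R]_d) (p' : 'cV[R]_n) i :
    (forall k, 0 <= p k 0 <= 1) -> (forall k, 0 <= q k 0 <= 1) ->
    (forall k, 0 <= p' k 0 <= 1) -> q i 0 = 0 ->
    0 <= (A *m q) i 0 + (B *m p) i 0 + (E *m p') i 0.
  move=> p01 q01 p'01 qi; rewrite leNgt; apply/negP; rewrite -oppr_gt0 => drive0.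
  have [|//|/(_ i)/= + _] := @no_negative_drive R d n r T alpha A B E C D tau1 tau2 tau3
    p q p' (pred1 i) pred0 _ T_gt0 alpha_01 rowsum_C rowsum_D ad1 ad2 ad3
    t10 t20 t30 pos p01 q01 p'01 drive0.
    by move=> k /eqP->; rewrite opprK.
  by rewrite eqxx.
have drive_output (q : 'cV[R]_d) (p' : 'cV[R]_n) j :
    (forall k, 0 <= q k 0 <= 1) -> (forall k, 0 <= p' k 0 <= 1) ->
    0 <= (C *m q) j 0 + (D *m p') j 0.
  move=> q01 p'01; rewrite leNgt; apply/negP; rewrite -oppr_gt0 => drive0.
  have [//||_ /(_ j)/=] := @no_negative_drive R d n r T alpha A B E C D tau1 tau2 tau3
    0 q p' pred0 (pred1 j) _ T_gt0 alpha_01 rowsum_C rowsum_D ad1 ad2 ad3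
    t10 t20 t30 pos (zero_itv d) q01 p'01 drive0.
    by move=> k /eqP->; rewrite opprK.
  by rewrite eqxx.
have entry m m' (M : 'M[R]_(m, m')) i j : (M *m (delta_mx j 0 : 'cV[R]_m')) i 0 = M i j.
  by rewrite -colE mxE.
have [mA nB nC nD nE] : [/\ metzler A, nonneg_mx B, nonneg_mx C, nonneg_mx D & nonneg_mx E].
  split.
  - move=> i j ij; have := @drive_state 0 (delta_mx j 0) 0 i (zero_itv d) (unit_itv d j)
      (zero_itv n).
    by rewrite !mulmx0 entry !mxE !addr0 (negbTE ij)/=; apply.
  - move=> i j; have := @drive_state (delta_mx j 0) 0 0 i (unit_itv d j) (zero_itv d)
      (zero_itv n).
    by rewrite !mulmx0 entry !mxE addr0 add0r; apply.
  - move=> i j; have := @drive_output (delta_mx j 0) 0 i (unit_itv d j) (zero_itv n).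
    by rewrite mulmx0 entry mxE addr0.
  - move=> i j; have := @drive_output 0 (delta_mx j 0) i (zero_itv d) (unit_itv n j).
    by rewrite mulmx0 entry mxE add0r.
  - move=> i j; have := @drive_state 0 0 (delta_mx j 0) i (zero_itv d) (zero_itv d)
      (unit_itv n j).
    by rewrite !mulmx0 entry !mxE !add0r; apply.
split=> // sigma1 sigma2 sigma3 as1 as2 as3.
exact: positive_system_of_sign_conditions.
Qed.
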